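(* Let $b\ge 2$ be an integer and $D\subset\{0,1,\dots,b-1\}$, and suppose that either (i) $b\geq 5$ and $\#D=b-1$, or (ii) $b=4$ and $D=\{0,1,2\}$ or $D=\{1,2,3\}$. Let $K=K_{b,D}$ and $\kappa=\dim_{\mathrm H}(K)$. Then there exist an effectively-computable constant $\varrho>0$ and a constant $C>0$ such that \[ \mathcal N_K(T)\leq C\,T^{2\kappa-\varrho}\qquad\text{for all integers } T\ge 1. \]
   Context: For an integer $b\ge 2$ and $D\subset\{0,\dots,b-1\}$ with $|D|\ge 2$, the missing-digit set $K_{b,D}$ is the set of real numbers in $[0,1]$ having at least one base-$b$ expansion with all digits in $D$. For a compact $K\subset\mathbb R$ and an integer $T\ge1$, $\mathcal N_K(T)=\#\{x\in K:\ qx\in\mathbb Z\text{ for some integer }1\le q\le T\}$. $\dim_{\mathrm H}$ denotes Hausdorff dimension. *)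

(* Defs.v *)
From mathcomp Require Export all_boot all_order all_algebra.
From mathcomp Require Export all_classical all_reals all_analysis.
Export Order.TTheory GRing.Theory Num.Theory.
Export numFieldNormedType.Exports.

Set Implicit Arguments.
Unset Strict Implicit.
Unset Printing Implicit Defensive.

Local Open Scope classical_set_scope.
Local Open Scope ring_scope.

Definition diam (R : realType) (A : set R) : \bar R :=
  ereal_sup ([set 0%E] `|` [set `|xy.1 - xy.2|%:E | xy in A `*` A]).

(* The test on the empty set fixes the convention (diam set0)^0 = 0, whereas
   the library has 0 `^ 0 = 1. *)
Definition hausdorff_gauge (R : realType) (s : R) (A : set R) : \bar R :=
  if `[< A = set0 >] then 0%E else (diam A `^ s)%E.

Definition hausdorff_premeasure (R : realType) (s delta : R) (A : set R)
    : \bar R :=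
  ereal_inf [set (\sum_(0 <= i <oo) hausdorff_gauge s (U i))%E | U in
    [set U : nat -> set R | A `<=` \bigcup_i U i /\
                            forall i, (diam (U i) <= delta%:E)%E]].

(* The premeasure is nonincreasing in delta, so this supremum is its limit as
   delta tends to 0+. *)
Definition hausdorff_measure (R : realType) (s : R) (A : set R) : \bar R :=
  ereal_sup [set hausdorff_premeasure s delta A |
             delta in [set delta : R | 0 < delta]].

Definition hausdorff_dim (R : realType) (A : set R) : \bar R :=
  ereal_inf [set s%:E | s in
    [set s : R | 0 <= s /\ hausdorff_measure s A = 0%E]].

(* digits d 0, d 1, ... are those of b^-1, b^-2, ... *)
Definition missing_digit_set (R : realType) (b : nat) (D : {set 'I_b})
    : set R :=
  [set x : R | 0 <= x <= 1 /\
    exists2 d : nat -> 'I_b, (forall n, d n \in D) &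
      series (fun n => (d n : nat)%:R / b%:R ^+ n.+1 : R) n @[n --> \oo] --> x].
Arguments missing_digit_set R {b} D.

(* [counting] is the cardinality, with value +oo on infinite sets. *)
Definition rational_count (R : realType) (K : set R) (T : nat) : \bar R :=
  counting [set x : R | K x /\
    exists2 q : nat, (1 <= q <= T)%N & q%:R * x \is a Num.int].

(* Partial recursive functions. Arguments are passed as a list; a missing
   argument is read as 0. *)
Inductive recfun : Type :=
| RZero
| RSucc
| RProj of nat
| RComp of recfun & seq recfun
| RPrec of recfun & recfun
| RMu of recfun.

Inductive rec_eval : recfun -> seq nat -> nat -> Prop :=
| EvalZero v : rec_eval RZero v 0%N
| EvalSucc v : rec_eval RSucc v (nth 0%N v 0%N).+1
| EvalProj i v : rec_eval (RProj i) v (nth 0%N v i)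
| EvalComp f gs v ws y :
    rec_evals gs v ws -> rec_eval f ws y -> rec_eval (RComp f gs) v y
| EvalPrec0 f g v y : rec_eval f v y -> rec_eval (RPrec f g) (0%N :: v) y
| EvalPrecS f g n v y z :
    rec_eval (RPrec f g) (n :: v) y -> rec_eval g [:: n, y & v] z ->
    rec_eval (RPrec f g) (n.+1 :: v) z
| EvalMu f v n (h : nat -> nat) :
    (forall k, (k < n)%N -> rec_eval f (k :: v) (h k).+1) ->
    rec_eval f (n :: v) 0%N -> rec_eval (RMu f) v n
with rec_evals : seq recfun -> seq nat -> seq nat -> Prop :=
| EvalsNil v : rec_evals [::] v [::]
| EvalsCons g gs v w ws :
    rec_eval g v w -> rec_evals gs v ws -> rec_evals (g :: gs) v (w :: ws).

(* The program e computes the real number x from the parameters v: given a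
   precision n as well, it returns the numerator of a fraction of denominator
   n.+1 at distance at most 1 / n.+1 from x. The numerator is a natural number,
   so this is meant for (and forces) 0 <= x. *)
Definition computes_real (R : realType) (e : recfun) (v : seq nat) (x : R) :=
  forall n : nat, exists2 m : nat,
    rec_eval e (n :: v) m & `|x - m%:R / n.+1%:R| <= n.+1%:R^-1.

Definition digit_code (b : nat) (D : {set 'I_b}) : nat :=
  (\sum_(i in D) 2 ^ i)%N.

(* Main.v *)
(* Each admissible D omits a single digit d0. Let A_k be the set of integers with
   k digits, all in D, and N = b ^ k > T ^ 2. Fractions of denominator at most T
   are more than 1 / N apart, so those in K are counted by the a in A_k such that
   a q lies within T of a multiple of N for some q <= T. Majorising this condition
   by a Fejer kernel and expanding, the count is at most a constant times
     (T / N) (T |A_k| + \sum_(n < N) d(n) |S(n / N)|),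
   where S(x) = \sum_(a in A_k) e(a x) factors over the digits and d(n) is the
   number of divisors of n. A power saving thus follows, on taking N slightly larger
   than T ^ 2, once the l^1 norm of S is at most (theta (b - 1) sqrt b) ^ k for some
   theta < 1. Cauchy-Schwarz only gives theta = sqrt (b / (b - 1)). To do better,
   |f| is bounded, for f(v) = \sum_(d in D) v ^ d, by a polynomial of degree two in
   |f| ^ 2, whose averages over the b-th roots of a point of the unit circle are
   explicit; this uses the fourth moment of f, and for b <= 12 a weight
   1 + om Re v as well. For b = 4 and D an interval, |f(v)| = |1 + 2 Re v| and the
   bound is direct. Finally, the Hausdorff dimension of K is at least
   log (b - 1) / log b because relabelling digits maps K onto [0, 1] by a map that
   is Hoelder with this exponent. *)
From Stdlib Require Import ZArith.
Require Import Defs.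
From mathcomp Require Import zify ring lra ssrZ.
From mathcomp Require Import complex.

Set Implicit Arguments.
Unset Strict Implicit.
Unset Printing Implicit Defensive.
Delimit Scope Z_scope with BZ.
Local Open Scope classical_set_scope.
Local Open Scope ring_scope.

(** * Complex moduli and roots of unity *)

(** The norm of the numeric ring [R[i]] has its values in [R[i]]; the estimates need a modulus in
    [R]. *)
Definition cmod (R : realType) (z : R[i]) : R := ComplexField.Normc.normc z.

Section ComplexModulus.
Variable R : realType.
Implicit Types (z w : R[i]) (x y : R).
Local Notation RC := (real_complex R).

Lemma cmodE z : cmod z = Num.sqrt (Re z ^+ 2 + Im z ^+ 2).
Proof. by case: z. Qed.

Lemma cmod_ge0 z : 0 <= cmod z.
Proof. by rewrite cmodE sqrtr_ge0. Qed.

Lemma sqr_cmod z : cmod z ^+ 2 = Re z ^+ 2 + Im z ^+ 2.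
Proof. by rewrite cmodE sqr_sqrtr ?addr_ge0 ?sqr_ge0. Qed.

Lemma cmodM z w : cmod (z * w) = cmod z * cmod w.
Proof. exact: ComplexField.Normc.normcM. Qed.

Lemma cmod0 : cmod (0 : R[i]) = 0.
Proof. exact: ComplexField.Normc.normc0. Qed.

Lemma cmod1 : cmod (1 : R[i]) = 1.
Proof. exact: ComplexField.Normc.normc1. Qed.

Lemma cmodX z n : cmod (z ^+ n) = cmod z ^+ n.
Proof. by elim: n => [|n IH]; rewrite ?expr0 ?cmod1 // !exprS cmodM IH. Qed.

Lemma cmodD z w : cmod (z + w) <= cmod z + cmod w.
Proof. exact: le_normcD. Qed.

Lemma cmod_sum (I : Type) (r : seq I) (P : pred I) (F : I -> R[i]) :
  cmod (\sum_(i <- r | P i) F i) <= \sum_(i <- r | P i) cmod (F i).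
Proof.
elim/big_ind2 : _ => [|z1 x1 z2 x2 h1 h2|//]; first by rewrite cmod0.
by apply: le_trans (cmodD _ _) _; rewrite lerD.
Qed.

Lemma ReD z w : Re (z + w) = Re z + Re w. Proof. by case: z w => [? ?] []. Qed.
Lemma ReM z w : Re (z * w) = Re z * Re w - Im z * Im w.
Proof. by case: z w => [? ?] []. Qed.
Lemma ImM z w : Im (z * w) = Re z * Im w + Im z * Re w.
Proof. by case: z w => [? ?] []. Qed.
Lemma ReMr x z : Re (RC x * z) = x * Re z.
Proof. by rewrite ReM /= mul0r subr0. Qed.

Lemma Re_sum (I : Type) (r : seq I) (P : pred I) (F : I -> R[i]) :
  Re (\sum_(i <- r | P i) F i) = \sum_(i <- r | P i) Re (F i).
Proof. by apply: (big_morph (@Re R)) => // z w; rewrite ReD. Qed.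

Lemma cmod_real x : 0 <= x -> cmod (RC x) = x.
Proof. by move=> x0; rewrite cmodE /= expr0n addr0 sqrtr_sqr ger0_norm. Qed.

Lemma cmod_nat n : cmod (n%:R : R[i]) = n%:R.
Proof. by rewrite -(rmorph_nat RC) cmod_real. Qed.

Lemma Re_le_cmod z : Re z <= cmod z.
Proof.
rewrite cmodE (le_trans (ler_norm _)) // -sqrtr_sqr ler_sqrt ?addr_ge0 ?sqr_ge0 //.
by rewrite lerDl sqr_ge0.
Qed.

Lemma Re_geN_cmod z : - cmod z <= Re z.
Proof.
rewrite lerNl cmodE (le_trans (ler_norm _)) // normrN -sqrtr_sqr.
by rewrite ler_sqrt ?addr_ge0 ?sqr_ge0 // lerDl sqr_ge0.
Qed.

Lemma conjcE z : z^*%C = Complex (Re z) (- Im z).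
Proof. by case: z. Qed.

Lemma mul_conjc z : z * z^*%C = RC (cmod z ^+ 2).
Proof.
by apply/eqP; rewrite eq_complex ReM ImM conjcE sqr_cmod /=; apply/andP; split;
  apply/eqP; ring.
Qed.

Lemma cmod_conjc z : cmod z^*%C = cmod z.
Proof. by rewrite !cmodE conjcE /= sqrrN. Qed.

Lemma unit_conjc z : cmod z = 1 -> z * z^*%C = 1.
Proof. by move=> z1; rewrite mul_conjc z1 expr1n. Qed.

Lemma unit_Re_bounds z : cmod z = 1 -> -1 <= Re z <= 1.
Proof.
by move=> z1; have := Re_le_cmod z; have := Re_geN_cmod z; rewrite z1 => -> ->.
Qed.

Lemma real_complex_inj : injective RC.
Proof. by move=> x y []. Qed.

End ComplexModulus.

Section UnitCircle.
Variable R : realType.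
Implicit Types (x y : R) (m n : nat).

Definition expi (x : R) : R[i] := Complex (cos x) (sin x).

Lemma expiD x y : expi (x + y) = expi x * expi y.
Proof.
apply/eqP; rewrite eq_complex ReM ImM /= cosD sinD; apply/andP; split => //.
by apply/eqP; ring.
Qed.

Lemma expi0 : expi 0 = 1.
Proof. by rewrite /expi cos0 sin0. Qed.

Lemma expiMn x n : expi (x *+ n) = expi x ^+ n.
Proof. by elim: n => [|n IH]; rewrite ?mulr0n ?expi0 // mulrS exprS expiD IH. Qed.

Lemma cmod_expi x : cmod (expi x) = 1.
Proof. by rewrite cmodE /= cos2Dsin2 sqrtr1. Qed.

Definition zroot (n : nat) : R[i] := expi (2 * pi / n%:R).

Lemma cmod_zroot n : cmod (zroot n) = 1.
Proof. exact: cmod_expi. Qed.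

Lemma cmod_zrootX n m : cmod (zroot n ^+ m) = 1.
Proof. by rewrite cmodX cmod_zroot expr1n. Qed.

Lemma zrootXn n : (0 < n)%N -> zroot n ^+ n = 1.
Proof.
move=> n0; rewrite /zroot -expiMn -[_ *+ n]mulr_natr divfK ?pnatr_eq0 -?lt0n //.
by rewrite /expi mulr_natl cos2pi sin2pi.
Qed.

Lemma zrootXMn n m : (0 < m)%N -> (0 < n)%N -> zroot (m * n) ^+ n = zroot m.
Proof.
move=> m0 n0; rewrite /zroot -expiMn -[_ *+ n]mulr_natr; congr expi.
by rewrite natrM; field; rewrite !pnatr_eq0 -!lt0n m0 n0.
Qed.

(** With [y = pi m / n] in [(0, pi)], equality of real parts would give [cos (2 y) = 1], that is
    [sin y = 0]. *)
Lemma zrootX_eq1 n m : (0 < m < n)%N -> zroot n ^+ m != 1.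
Proof.
case/andP=> m0 mn; have n0 : (0 < n)%N by apply: leq_trans mn.
rewrite /zroot -expiMn -[_ *+ m]mulr_natr; apply/negP => /eqP -[h _].
set x := _ * _ in h.
have xE : x = (pi * (m%:R / n%:R)) *+ 2.
  by rewrite /x -[RHS]mulr_natr; field; rewrite pnatr_eq0 -lt0n.
have s0 : 0 < sin (pi * (m%:R / n%:R)) :> R.
  apply: sin_gt0_pi; rewrite mulr_gt0 ?pi_gt0 ?divr_gt0 ?ltr0n //=.
  by rewrite gtr_pMr ?pi_gt0 // ltr_pdivrMr ?ltr0n // mul1r ltr_nat.
move: h; rewrite xE cos_mulr2n cos2sin2 => h.
suff : sin (pi * (m%:R / n%:R)) ^+ 2 = 0 :> R.
  by move/eqP; rewrite sqrf_eq0 gt_eqF.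
by move: h; rewrite -[(1 - _) *+ 2]mulr_natr; lra.
Qed.

Lemma sum_zroot n m : (0 < n)%N ->
  \sum_(i < n) (zroot n ^+ i) ^+ m = if (n %| m)%N then n%:R else 0.
Proof.
move=> n0; have zn := zrootXn n0.
have -> : \sum_(i < n) (zroot n ^+ i) ^+ m = \sum_(i < n) (zroot n ^+ (m %% n)) ^+ i.
  apply: eq_bigr => i _; rewrite -!exprM {1}(divn_eq m n) mulnDr exprD mulnCA.
  by rewrite mulnA mulnC exprM zn expr1n mul1r mulnC.
have [dv|ndv] := ifPn.
  rewrite (eqP dv) expr0 (eq_bigr (fun=> 1)) ?sumr_const ?card_ord // => i _.
  exact: expr1n.
set q := zroot n ^+ _.
have q1 : q != 1 by rewrite zrootX_eq1 // ltn_mod n0 andbT lt0n.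
have := subrX1 q n.
rewrite /q -exprM mulnC exprM zn expr1n subrr => /esym/eqP.
by rewrite mulf_eq0 subr_eq0 (negbTE q1) => /eqP.
Qed.

(** Summing over the [n]-th roots of [u ^ n] keeps only exponents divisible by [n]; this makes the
    averages below explicit. *)
Lemma sum_zroot_pow n m (u : R[i]) : (0 < n)%N ->
  \sum_(i < n) (u * zroot n ^+ i) ^+ m =
  if (n %| m)%N then n%:R * (u ^+ n) ^+ (m %/ n) else 0.
Proof.
move=> n0; under eq_bigr do rewrite exprMn.
rewrite -mulr_sumr sum_zroot //; case: ifP => [dv|_]; last by rewrite mulr0.
by rewrite mulrC -exprM mulnC divnK.
Qed.

End UnitCircle.

(** * The transfer operator of a digit set *)

Definition dsum (R : realType) b (D : {set 'I_b}) (v : R[i]) : R[i] :=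
  \sum_(d in D) v ^+ d.

(* w(v) = 1 + om Re v is a positive subsolution of the transfer operator
   w |-> (v |-> \sum_(y ^ b = v) |dsum D y| w(y)). *)
Definition subsolution (R : realType) b (D : {set 'I_b}) (om lam : R) :=
  forall u : R[i], cmod u = 1 ->
    \sum_(i < b) cmod (dsum D (u * zroot R b ^+ i)) *
       (1 + om * Re (u * zroot R b ^+ i)) <= lam * (1 + om * Re (u ^+ b)).

Lemma dsumC1 (R : realType) b (d0 : 'I_b) (v : R[i]) :
  dsum [set~ d0]%SET v = \sum_(d < b) (d != d0)%:R * v ^+ d.
Proof.
rewrite /dsum big_mkcond; apply: eq_bigr => d _; rewrite !inE.
by case: ifP => //=; rewrite ?mul1r ?mul0r.
Qed.

Lemma cmod_dsum_le (R : realType) b (D : {set 'I_b}) (v : R[i]) :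
  cmod v = 1 -> cmod (dsum D v) <= #|D|%:R.
Proof.
move=> v1; apply: le_trans (cmod_sum _ _ _) _; rewrite -sum1_card natr_sum.
by apply: ler_sum => d _; rewrite cmodX v1 expr1n.
Qed.

Lemma cardC1_ord b (d0 : 'I_b) : #|[set~ d0]%SET| = b.-1.
Proof. by rewrite cardsC1 card_ord. Qed.

(* The difference of the two sides has a double zero at s0 and a zero at s1. *)
Lemma le_quartic (R : realType) (s s0 s1 : R) : 0 <= s <= s1 -> 0 <= s0 ->
  2 * s0 * (s0 + s1) ^+ 2 * s <=
  (s0 + s1) ^+ 2 * (s0 ^+ 2 + s ^+ 2) - (s ^+ 2 - s0 ^+ 2) ^+ 2.
Proof.
move=> /andP[sge0 ss1] s00; rewrite -subr_ge0.
have -> : (s0 + s1) ^+ 2 * (s0 ^+ 2 + s ^+ 2) - (s ^+ 2 - s0 ^+ 2) ^+ 2 -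
    2 * s0 * (s0 + s1) ^+ 2 * s =
    (s - s0) ^+ 2 * ((s1 - s) * (s1 + s + 2 * s0)) by ring.
by rewrite mulr_ge0 ?sqr_ge0 // mulr_ge0 //; lra.
Qed.

(** * Integer polynomials as coefficient lists *)

Section ListPolynomials.
Variable R : realType.
Implicit Types (s t : seq Z) (v : R[i]) (c : Z).

(** Coefficients are binary integers, so that certificates can be checked by [vm_compute]; [zc] and
    [zr] embed them in [R[i]] and [R]. *)
Definition zc c : R[i] := (int_of_Z c)%:~R.
Definition zr c : R := (int_of_Z c)%:~R.

Lemma zcD c c' : zc (c + c')%BZ = zc c + zc c'.
Proof. by rewrite /zc (rmorphD int_of_Z) rmorphD. Qed.
Lemma zcM c c' : zc (c * c')%BZ = zc c * zc c'.
Proof. by rewrite /zc (rmorphM int_of_Z) rmorphM. Qed.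
Lemma zrD c c' : zr (c + c')%BZ = zr c + zr c'.
Proof. by rewrite /zr (rmorphD int_of_Z) rmorphD. Qed.
Lemma zrM c c' : zr (c * c')%BZ = zr c * zr c'.
Proof. by rewrite /zr (rmorphM int_of_Z) rmorphM. Qed.
Lemma zrN c : zr (- c)%BZ = - zr c.
Proof. by rewrite /zr (rmorphN int_of_Z) rmorphN. Qed.
Lemma zrB c c' : zr (c - c')%BZ = zr c - zr c'.
Proof. by rewrite -zrN -zrD. Qed.
Lemma zcR c : zc c = real_complex R (zr c).
Proof. by rewrite /zc /zr rmorph_int. Qed.
Lemma zr_nat n : zr (Z.of_nat n) = n%:R.
Proof.
rewrite /zr; have -> : int_of_Z (Z.of_nat n) = n%:Z by lia.
by [].
Qed.
Lemma ler_zr c c' : (c <=? c')%BZ -> zr c <= zr c'.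
Proof. by move=> h; rewrite /zr ler_int; lia. Qed.

Fixpoint pev s v : R[i] := if s is c :: s' then zc c + v * pev s' v else 0.
End ListPolynomials.

Fixpoint padd (s t : seq Z) : seq Z :=
  match s, t with
  | [::], _ => t
  | _, [::] => s
  | c :: s', d :: t' => (c + d)%BZ :: padd s' t'
  end.
Definition pscale (c : Z) (s : seq Z) := map (Z.mul c) s.
Fixpoint pmul (s t : seq Z) : seq Z :=
  if s is c :: s' then padd (pscale c t) (0%BZ :: pmul s' t) else [::].
Definition pmono (n : nat) (c : Z) : seq Z := ncons n 0%BZ [:: c].

Section ListPolynomialsTheory.
Variable R : realType.
Implicit Types (s t : seq Z) (v : R[i]) (c : Z).

Lemma zc0 : zc R 0%BZ = 0. Proof. by []. Qed.

Lemma pevD s t v : pev (padd s t) v = pev s v + pev t v.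
Proof.
elim: s t => [|c s IH] [|d t] /=; rewrite ?add0r ?addr0 // zcD IH.
by ring.
Qed.

Lemma pevZ c s v : pev (pscale c s) v = zc R c * pev s v.
Proof. by elim: s => [|d s IH] /=; rewrite ?mulr0 // zcM IH; ring. Qed.

Lemma pevM s t v : pev (pmul s t) v = pev s v * pev t v.
Proof.
by elim: s => [|c s IH] /=; rewrite ?mul0r // pevD pevZ /= IH zc0; ring.
Qed.

Lemma pev_mono n c v : pev (pmono n c) v = zc R c * v ^+ n.
Proof.
rewrite /pmono; elim: n => [|n IH] /=; first by rewrite mulr0 addr0 mulr1.
by rewrite IH exprS zc0; ring.
Qed.

Lemma pevE s v : pev s v = \sum_(j < size s) zc R (nth 0%BZ s j) * v ^+ j.
Proof.
elim: s => [|c s IH] /=; first by rewrite big_ord0.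
rewrite big_ord_recl /= mulr1 IH mulr_sumr; congr (_ + _).
by apply: eq_bigr => j _; rewrite /= exprS; ring.
Qed.

Lemma pevE_widen n s v : (size s <= n)%N ->
  pev s v = \sum_(j < n) zc R (nth 0%BZ s j) * v ^+ j.
Proof.
move=> sn; rewrite pevE (big_ord_widen _ (fun j => zc R (nth 0%BZ s j) * v ^+ j) sn).
rewrite big_mkcond; apply: eq_bigr => j _; case: ifP => // /negbT.
by rewrite -leqNgt => h; rewrite nth_default // zc0 mul0r.
Qed.

Lemma pev_mkseq (F : nat -> Z) n v :
  pev (mkseq F n) v = \sum_(j < n) zc R (F j) * v ^+ j.
Proof.
rewrite (pevE_widen (n := n)) ?size_mkseq //.
by apply: eq_bigr => j _; rewrite nth_mkseq.
Qed.

Lemma sum_ord_mul (V : zmodType) (F : nat -> V) m n :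
  \sum_(j < m * n) F j = \sum_(q < m) \sum_(r < n) F (q * n + r)%N.
Proof.
elim: m => [|m IH]; first by rewrite !big_ord0.
rewrite big_ord_recr /= -IH mulSn addnC.
by rewrite big_split_ord.
Qed.

(** The factor [v] shifts exponent [j] to [j + 1], and only multiples of [b] survive the sum. In
    range are [b], [2 b], [3 b] and [4 b], and the last has coefficient zero. *)
Lemma sum_pev b s (u : R[i]) : (0 < b)%N -> (size s <= 4 * b)%N ->
  (nth 0%BZ s (4 * b).-1 = 0)%BZ ->
  \sum_(i < b) (u * zroot R b ^+ i) * pev s (u * zroot R b ^+ i) =
  b%:R * (zc R (nth 0%BZ s b.-1) * u ^+ b +
          zc R (nth 0%BZ s (2 * b).-1) * (u ^+ b) ^+ 2 +
          zc R (nth 0%BZ s (3 * b).-1) * (u ^+ b) ^+ 3).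
Proof.
move=> b0 sb s0.
pose F j := zc R (nth 0%BZ s j) *
  (if (b %| j.+1)%N then b%:R * (u ^+ b) ^+ (j.+1 %/ b) else 0).
have -> : \sum_(i < b) (u * zroot R b ^+ i) * pev s (u * zroot R b ^+ i) =
    \sum_(j < 4 * b) F j.
  under eq_bigr do rewrite (pevE_widen _ sb) mulr_sumr.
  rewrite exchange_big /=; apply: eq_bigr => j _.
  rewrite /F -sum_zroot_pow // mulr_sumr; apply: eq_bigr => i _.
  by rewrite exprS; ring.
rewrite sum_ord_mul.
have FE q : \sum_(r < b) F (q * b + r)%N =
    zc R (nth 0%BZ s (q.+1 * b).-1) * (b%:R * (u ^+ b) ^+ q.+1).
  case: b b0 @F sb s0 => // b _ F _ _; rewrite big_ord_recr /= big1 ?add0r.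
    rewrite /F -addnS -mulSnr dvdn_mull // mulnK //.
    by congr (zc R (nth _ _ _) * _); lia.
  move=> r _; rewrite /F ifN ?mulr0 // -addnS dvdn_addr ?dvdn_mull //.
  by apply/negP => /dvdn_leq; have := ltn_ord r; lia.
under eq_bigr do rewrite FE.
rewrite !big_ord_recr big_ord0 /= s0 zc0 mul1n; ring.
Qed.

End ListPolynomialsTheory.

(** * Numerical certificates for bases 5 to 12 *)

Section Certificate.
Variables (b d : nat) (om sg : Z).

(** Moduli are scaled by 10: this is [(s0 + s1) ^ 2] of [le_quartic] with [s0 = sg] and
    [s1 = 10 (b - 1)], the latter bounding [10 |dsum v|]. *)
Definition cert_K : Z := ((sg + 10 * (Z.of_nat b - 1)) * (sg + 10 * (Z.of_nat b - 1)))%BZ.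
(* For |v| = 1 this evaluates to 100 v ^ (b - 1) |dsum v| ^ 2. *)
Definition cert_T : seq Z :=
  pscale 100%BZ (pmul (mkseq (fun j => if j == d then 0%BZ else 1%BZ) b)
                   (mkseq (fun j => if b.-1 - j == d then 0%BZ else 1%BZ)%N b)).
Definition cert_Y : seq Z := padd cert_T (pmono b.-1 (- (sg * sg))%BZ).
(** For [|v| = 1] the first factor is [v (200 - 2 om Re v)] and the second is [v ^ (2 b - 2)] times
    the right side of [le_quartic] at [10 |dsum v|]. The product is [v ^ (2 b - 1)] times a real
    trigonometric polynomial. *)
Definition cert_Q : seq Z :=
  pmul [:: (- om)%BZ; 200%BZ; (- om)%BZ]
    (padd (pscale cert_K (padd (pmono (b.-1 + b.-1) (sg * sg)%BZ)
                               (pmul (pmono b.-1 1%BZ) cert_T)))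
          (pscale (-1)%BZ (pmul cert_Y cert_Y))).

(** [q0] and [q1] are what remains after summation: the sum over the [b] points is
    [b (q0 + q1 Re (u ^ b))]. The inequality to prove is affine in [Re (u ^ b)], and the last two
    tests are its endpoints 1 and -1. The bound [om <= 50] keeps the weight positive. *)
Definition cert_check (l : Z) : bool :=
  let Q := cert_Q in
  let q0 := nth 0%BZ Q (2 * b).-1 in
  let q1 := (nth 0 Q b.-1 + nth 0 Q (3 * b).-1)%BZ in
  let B := (100 * Z.of_nat b)%BZ in
  let A := (4 * sg * cert_K * l)%BZ in
  [&& (size Q == (4 * b).-1)%N,
      (0 <? sg)%BZ, (0 <=? om)%BZ, (om <=? 50)%BZ,
      (B * (q0 + q1) <=? A * (100 - om))%BZ &
      (B * (q0 - q1) <=? A * (100 + om))%BZ].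

End Certificate.

Section CertificateSound.
Variables (R : realType).
Local Notation RC := (real_complex R).
Variables (b d : nat) (om sg : Z).
Hypothesis db : (d < b)%N.
Let D := [set~ Ordinal db]%SET.

(** For [|v| = 1], [v ^ (b - 1)] times the conjugate of [dsum D v] is the polynomial with reversed
    coefficients. *)
Lemma pev_cert_T (v : R[i]) : cmod v = 1 ->
  pev (cert_T b d) v = v ^+ b.-1 * RC (100 * cmod (dsum D v) ^+ 2).
Proof.
move=> v1; rewrite /cert_T pevZ pevM !pev_mkseq.
have zif (c : bool) : zc R (if c then 0%BZ else 1%BZ) = (~~ c)%:R.
  by case: c.
rewrite rmorphM /= -mul_conjc dsumC1.
have -> : zc R 100%BZ = RC 100 by rewrite zcR; congr RC.
under eq_bigr do rewrite zif.
under [X in _ * (_ * X) = _]eq_bigr do rewrite zif.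
have -> : \sum_(i < b) (~~ (i == d :> nat))%:R * v ^+ i =
    \sum_(i < b) (i != Ordinal db)%:R * v ^+ i :> R[i] by [].
suff -> : \sum_(j < b) (~~ (b.-1 - j == d)%N)%:R * v ^+ j =
    v ^+ b.-1 * (\sum_(i < b) (i != Ordinal db)%:R * v ^+ i)^*%C by ring.
rewrite (reindex_inj rev_ord_inj) /= rmorph_sum mulr_sumr; apply: eq_bigr => i _.
rewrite rmorphM rmorph_nat rmorphXn /=.
have ib := ltn_ord i.
have -> : (b.-1 - (b - i.+1) = i)%N by lia.
have -> : v ^+ b.-1 = v ^+ (b - i.+1) * v ^+ i by rewrite -exprD; congr (_ ^+ _); lia.
rewrite mulrCA -mulrA -exprMn unit_conjc // expr1n mulr1.
by rewrite -val_eqE.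
Qed.

Lemma cert_sound (l : Z) : cert_check b d om sg l -> (1 < b)%N ->
  subsolution D (- (zr R om / 100)) (zr R l / 1000).
Proof.
case/and4P => /eqP szQ sg0 om0 /and3P[om50 c1 c2] b1 u u1.
have b0 : (0 < b)%N by apply: ltnW.
set s := zr R sg; set o := zr R om; set L := zr R l.
have s0 : 0 < s by rewrite /s /zr ltr0z; lia.
have o0 : 0 <= o by rewrite /o /zr ler0z; lia.
have o50 : o <= 50 by have := ler_zr R om50.
set K := (s + 10 * (b%:R - 1)) ^+ 2 : R.
have KE : zr R (cert_K b sg) = K.
  rewrite /cert_K /K zrM zrD zrM -/s.
  have -> : zr R (Z.of_nat b - 1)%BZ = b%:R - 1.
    by rewrite -[(_ - 1)%BZ]/(Z.of_nat b + - 1)%BZ zrD zr_nat.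
  by rewrite (_ : zr R 10%BZ = 10) // expr2.
have bR : 1 <= b%:R - 1 :> R.
  by rewrite lerBrDr -(natrD _ 1 1) ler_nat.
have K0 : 0 < K by rewrite exprn_gt0 //; lra.
pose v i := u * zroot R b ^+ i.
have v1 i : cmod (v i) = 1 by rewrite cmodM u1 cmod_zrootX mulr1.
pose t i := 100 * cmod (dsum D (v i)) ^+ 2 : R.
pose X i := K * (s ^+ 2 + t i) - (t i - s ^+ 2) ^+ 2.
pose w i := 1 - o / 100 * Re (v i).
have Re1 i := unit_Re_bounds (v1 i).
have w0 i : 0 <= w i.
  by rewrite /w; have /andP[] := Re1 i; nra.
(* [le_quartic] at [10 |dsum v|], multiplied by the nonnegative weight. *)
have step i : 20 * s * K * (cmod (dsum D (v i)) * w i) <= w i * X i.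
  rewrite mulrA mulrC ler_wpM2l //.
  have := @le_quartic R (10 * cmod (dsum D (v i))) s (10 * (b%:R - 1)).
  have h : cmod (dsum D (v i)) <= b%:R - 1.
    by rewrite (le_trans (cmod_dsum_le _ _)) // cardC1_ord -subn1 natrB.
  have h0 := cmod_ge0 (dsum D (v i)).
  move=> /(_ _ (ltW s0)) H.
  have {H} := H _; have -> : (0 <= 10 * cmod (dsum D (v i)) <= 10 * (b%:R - 1)) = true.
    by apply/andP; split; lra.
  move=> /(_ isT) H; rewrite /X /t -/K in H *.
  by rewrite exprMn in H; lra.
have evQ i : pev (cert_Q b d om sg) (v i) = v i ^+ (2 * b).-1 * RC (200 * w i * X i).
  rewrite /cert_Q pevM pevD !pevZ pevM !pevD pevM !pev_mono pev_cert_T //= -/(t i).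
  have vv : v i * (v i)^*%C = 1 by apply: unit_conjc.
  (* As [2 Re v = v + v^-1], the weight becomes a polynomial once multiplied by [v]. *)
  have wE : RC (200 * w i) * v i = zc R (- om)%BZ + v i * (zc R 200%BZ + v i * (zc R (- om)%BZ + v i * 0)).
    have -> : RC (200 * w i) = RC 200 - RC o * (v i + (v i)^*%C).
      rewrite addcJ -(rmorph_nat RC) -!rmorphM -rmorphB; congr RC.
      by rewrite /w; field.
    rewrite !zcR zrN -/o (_ : zr R 200%BZ = 200) // mulrBl -mulrA mulrDl.
    by rewrite [_^*%C * _]mulrC vv rmorphN; ring.
  have XE : RC (X i) = RC K * (RC s ^+ 2 + RC (t i)) - (RC (t i) - RC s ^+ 2) ^+ 2.
    by rewrite /X rmorphB rmorphM rmorphD !rmorphXn /= rmorphB rmorphXn.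
  have -> : RC (200 * w i * X i) = RC (200 * w i) * RC (X i) by rewrite -rmorphM.
  rewrite -wE XE !zcR KE zrN zrM -/s.
  rewrite (_ : zr R 1%BZ = 1) // (_ : zr R (-1)%BZ = -1) // !rmorphN !rmorphM rmorph1.
  have -> : v i ^+ (2 * b).-1 = v i * (v i ^+ b.-1 * v i ^+ b.-1).
    by rewrite -exprD -exprS; congr (_ ^+ _); lia.
  by rewrite exprD; ring.
have Qlast : nth 0%BZ (cert_Q b d om sg) (4 * b).-1 = 0%BZ.
  by rewrite nth_default // szQ.
have szQ' : (size (cert_Q b d om sg) <= 4 * b)%N by rewrite szQ leq_pred.
have := sum_pev u b0 szQ' Qlast.
set q1 := nth _ _ b.-1; set q2 := nth _ _ (2 * b).-1; set q3 := nth _ _ (3 * b).-1.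
set z := u ^+ b.
have z1 : cmod z = 1 by rewrite cmodX u1 expr1n.
have zz : z * z^*%C = 1 by apply: unit_conjc.
have -> : \sum_(i < b) (u * zroot R b ^+ i) * pev (cert_Q b d om sg) (u * zroot R b ^+ i)
   = z ^+ 2 * RC (\sum_(i < b) 200 * w i * X i).
  rewrite rmorph_sum mulr_sumr; apply: eq_bigr => i _.
  rewrite evQ mulrA -exprS prednK ?muln_gt0 // mulnC exprM; congr (_ ^+ _ * _).
  by rewrite /v exprMn -exprM mulnC exprM zrootXn // expr1n mulr1.
(* Multiplying by the inverse square of [z] centres the identity at exponent zero; then real parts
   are compared. *)
move=> /(congr1 (fun y => z^*%C ^+ 2 * y)).
rewrite mulrA -exprMn [_^*%C * z]mulrC zz expr1n mul1r => SQ.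
have {}SQ : \sum_(i < b) 200 * w i * X i = b%:R * (zr R q2 + (zr R q1 + zr R q3) * Re z).
  have E : z^*%C ^+ 2 * (b%:R * (zc R q1 * z + zc R q2 * z ^+ 2 + zc R q3 * z ^+ 3)) =
     b%:R * (zc R q1 * z^*%C * (z * z^*%C) + zc R q2 * (z * z^*%C)^+2 + zc R q3 * z * (z * z^*%C) ^+ 2) by ring.
  move: SQ; rewrite E zz !expr1n !mulr1 => /(congr1 (@Re R)).
  rewrite -[LHS]/(\sum_(i < b) 200 * w i * X i) => ->.
  by rewrite -(rmorph_nat RC) ReMr !ReD !zcR !ReMr conjcE /=; ring.
have /andP[z_l z_u] := unit_Re_bounds z1.
have z100 : zr R 100%BZ = 100 by [].
have z4 : zr R 4%BZ = 4 by [].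
have {c1} := ler_zr R c1; have {c2} := ler_zr R c2.
rewrite -/q1 -/q2 -/q3; move: (cert_K b sg) KE => kz KE; move: q1 q2 q3 SQ => y1 y2 y3 SQ.
rewrite !zrM !zrB !zrD KE zr_nat -/L -/s -/o.
rewrite !z100 z4.
set a0 := zr R y2; set a1 := zr R y1 + zr R y3 => c2 c1.
set S := \sum_(i < b) _.
have SE : S = \sum_(i < b) cmod (dsum D (v i)) * w i.
  by apply: eq_bigr => i _; rewrite /w mulNr.
have H1 : 200 * (20 * s * K * S) <= b%:R * (a0 + a1 * Re z).
  rewrite -SQ SE !mulr_sumr; apply: ler_sum => i _.
  by rewrite -[200 * w i * _]mulrA ler_pM2l // step.
(* Affine in [Re z] on [-1, 1], hence a convex combination of the endpoint tests [c1] and [c2]. *)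
have H2 : 100 * (b%:R * (a0 + a1 * Re z)) <= 4 * s * K * L * (100 - o * Re z).
  set Bb : R := b%:R in c1 c2 *; set M := 4 * s * K * L in c1 c2 *.
  nra.
have P0 : 0 < s * K by rewrite mulr_gt0.
by rewrite -(ler_pM2l P0); lra.
Qed.

End CertificateSound.

(* The triples - 100 om, 10 s0, 1000 lam, found by numerical optimisation. *)
Definition cert_param (b : nat) : Z * Z * Z :=
  match b with
  | 5 => (12, 14, 8899)%BZ | 6 => (15, 15, 11515)%BZ | 7 => (20, 14, 14147)%BZ
  | 8 => (20, 16, 16920)%BZ | 9 => (24, 15, 19687)%BZ | 10 => (25, 16, 22638)%BZ
  | 11 => (27, 16, 25572)%BZ | _ => (29, 16, 28615)%BZ
  end.

Lemma cert_all : all (fun b => all (fun d =>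
    let: (om, sg, l) := cert_param b in cert_check b d om sg l) (iota 0 b))
  (iota 5 8).
Proof. by vm_compute. Qed.

(** Squared form of [l / 1000 <= 998 / 1000 (b - 1) sqrt b], which stays in the integers. *)
Lemma cert_lambda : all (fun b =>
    let: (om, sg, l) := cert_param b in
    (0 <=? l)%BZ && (l * l <=? 998 * 998 * (Z.of_nat b.-1 * Z.of_nat b.-1 * Z.of_nat b))%BZ)
  (iota 5 8).
Proof. by vm_compute. Qed.

Lemma subsolution_small (R : realType) b (d0 : 'I_b) : (5 <= b <= 12)%N ->
  exists om lam : R, [/\ -1/2 <= om <= 1/2, 0 <= lam,
    lam <= 998 / 1000 * (b.-1%:R * Num.sqrt b%:R) & subsolution [set~ d0]%SET om lam].
Proof.
move=> bb; have bi : b \in iota 5 8 by rewrite mem_iota; lia.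
have := allP cert_all b bi; have := allP cert_lambda b bi.
case: (cert_param b) => [[om sg] l] /andP[l0 ll] /allP/(_ d0).
rewrite mem_iota /= ltn_ord => /(_ isT) ck.
exists (- (zr R om / 100)), (zr R l / 1000).
have L0 : 0 <= zr R l by have := ler_zr R l0.
split.
- case/and4P: ck => _ _ o0 /andP[h50 _].
  have := ler_zr R o0; have := ler_zr R h50.
  rewrite -[zr R 50%BZ]/(50%:R) -[zr R 0%BZ]/(0%:R) => h1 h2.
  by apply/andP; split; lra.
- lra.
- have := ler_zr R ll; rewrite !zrM !zr_nat (_ : zr R 998%BZ = 998) // => h.
  have X0 : 0 <= b.-1%:R * Num.sqrt b%:R :> R by rewrite mulr_ge0 ?sqrtr_ge0.
  have X2 : (b.-1%:R * Num.sqrt b%:R) ^+ 2 = b.-1%:R * b.-1%:R * b%:R :> R.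
    by rewrite exprMn sqr_sqrtr // expr2.
  move: X2 X0 h; set X := _ * Num.sqrt _ => <- X0 h.
  suff : zr R l <= 998 * X by lra.
  rewrite leNgt; apply/negP => lt; move: h; rewrite leNgt => /negP; apply.
  have Y0 : 0 <= 998 * X by lra.
  have -> : 998 * 998 * X ^+ 2 = (998 * X) * (998 * X) by ring.
  exact: ltr_pM.
- have := @cert_sound R b d0 om sg (ltn_ord d0) l ck.
  have -> : Ordinal (ltn_ord d0) = d0 by apply: val_inj.
  by apply; lia.
Qed.

(** * Second and fourth moments of the digit polynomial, and bases from 13 on *)

Section Moments.
Variables (R : realType) (b' : nat).
Local Notation b := b'.+1.
Local Notation RC := (real_complex R).
Variable u : R[i].
Hypothesis u1 : cmod u = 1.
Let z := u ^+ b.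
Let v i := u * zroot R b ^+ i.

Let v1 i : cmod (v i) = 1.
Proof. by rewrite cmodM u1 cmod_zrootX mulr1. Qed.

Let z1 : cmod z = 1.
Proof. by rewrite cmodX u1 expr1n. Qed.

Let vb i : v i ^+ b = z.
Proof. by rewrite exprMn -exprM mulnC exprM zrootXn // expr1n mulr1. Qed.

Let conj_vX i (m : nat) : (m <= b)%N -> (v i)^*%C ^+ m = v i ^+ (b - m) * z^*%C.
Proof.
move=> mb; have vv : v i * (v i)^*%C = 1 by apply: unit_conjc.
have -> : z^*%C = (v i)^*%C ^+ m * (v i)^*%C ^+ (b - m).
  by rewrite -exprD subnKC // -(vb i) rmorphXn.
by rewrite mulrCA -exprMn vv expr1n mulr1.
Qed.

(** Orthogonality: distinct exponents below [b] differ by a non-multiple of [b], so the cross terms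
    cancel. *)
Lemma parseval (g : 'I_b -> R[i]) :
  \sum_(i < b) cmod (\sum_(m < b) g m * v i ^+ m) ^+ 2 =
  b%:R * \sum_(m < b) cmod (g m) ^+ 2.
Proof.
apply: (@real_complex_inj R); rewrite rmorph_sum rmorphM rmorph_nat rmorph_sum /=.
under eq_bigr do rewrite -mul_conjc rmorph_sum /= mulr_suml.
under [in RHS]eq_bigr do rewrite -mul_conjc.
rewrite exchange_big mulr_sumr /=; apply: eq_bigr => m _.
under eq_bigr do rewrite mulr_sumr.
rewrite exchange_big (bigD1 m) //= [X in _ + X]big1 ?addr0 => [|m' nm].
  rewrite (eq_bigr (fun=> g m * (g m)^*%C)) ?sumr_const ?card_ord ?mulr_natl // => i _.
  by rewrite rmorphM rmorphXn /= mulrACA -exprMn (unit_conjc (v1 i)) expr1n mulr1.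
have vE (i : 'I_b) : g m * v i ^+ m * (g m' * v i ^+ m')^*%C =
    g m * (g m')^*%C * z^*%C * v i ^+ (m + (b - m')).
  rewrite rmorphM rmorphXn /= conj_vX; last exact: ltnW.
  by rewrite exprD; ring.
rewrite (eq_bigr _ (fun i _ => vE i)) -mulr_sumr sum_zroot_pow // ifN ?mulr0 //.
have := ltn_ord m; have := ltn_ord m' => h1 h2.
apply/negP => /dvdnP[k kE]; move/eqP: nm; apply; apply: val_inj => /=.
case: k kE => [|[|k]]; first lia.
  by rewrite mul1n; lia.
by rewrite !mulSn; lia.
Qed.

Variable d0 : 'I_b.
Let D := [set~ d0]%SET.
Let a (d : 'I_b) : R := (d != d0)%:R.

Let dsumE i : dsum D (v i) = \sum_(m < b) RC (a m) * v i ^+ m.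
Proof. by rewrite dsumC1; apply: eq_bigr => m _; rewrite /a rmorph_nat. Qed.

Lemma second_moment : \sum_(i < b) cmod (dsum D (v i)) ^+ 2 = b%:R * (b%:R - 1).
Proof.
under eq_bigr do rewrite dsumE.
rewrite parseval; congr (_ * _).
rewrite (eq_bigr (fun m => (m != d0)%:R)) => [|m _].
  have -> : b%:R - 1 = (#|D|)%:R :> R by rewrite cardC1_ord /= -natr1 addrK.
  rewrite -sum1_card natr_sum [RHS]big_mkcond /=.
  by apply: eq_bigr => m _; rewrite !inE; case: (m != d0).
by rewrite cmod_real ?ler0n // /a; case: (m != d0); rewrite ?expr1n ?expr0n.
Qed.

(** [p] and [q] split the cyclic autocorrelation of the digit indicator according to whether [d + m]
    stays below [b]. As [v ^ b = z], a wrapped term acquires the factor [z^-1], so [h m] is the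
    [m]-th coefficient of [|dsum D v| ^ 2]. *)
Let p (m : 'I_b) : R := \sum_(d < b | (d + m < b)%N) a d * a (d + m)%R.
Let q (m : 'I_b) : R := \sum_(d < b | ~~ (d + m < b)%N) a d * a (d + m)%R.
Let h m : R[i] := RC (p m) + RC (q m) * z^*%C.

Let sqr_dsumE i : RC (cmod (dsum D (v i)) ^+ 2) = \sum_(m < b) h m * v i ^+ m.
Proof.
have vv : v i * (v i)^*%C = 1 by apply: unit_conjc.
rewrite -mul_conjc dsumE rmorph_sum mulr_sumr /=.
under eq_bigr => d _.
  rewrite mulr_suml (reindex_inj (addrI d)) /=.
  over.
rewrite exchange_big /=; apply: eq_bigr => m _.
rewrite (bigID (fun d : 'I_b => (d + m < b)%N)) /= mulrDl; congr (_ + _).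
  rewrite /p rmorph_sum mulr_suml; apply: eq_bigr => d dm /=.
  rewrite modn_small // !rmorphM rmorphXn /= exprD.
  have -> : (a d -i* 0)%C = RC (a d) by rewrite oppr0.
  transitivity (RC (a d) * RC (a (d + m)) * v i ^+ m * (v i ^+ d * (v i)^*%C ^+ d)).
    by ring.
  by rewrite -exprMn vv expr1n mulr1.
rewrite /q rmorph_sum !mulr_suml; apply: eq_bigr => d dm /=.
have dmE : ((d + m) %% b = d + m - b)%N.
  rewrite -leqNgt in dm; have := ltn_ord d; have := ltn_ord m => h1 h2.
  by rewrite -{1}(subnK dm) modnDr modn_small //; lia.
rewrite dmE !rmorphM rmorphXn /=.
have -> : (a d -i* 0)%C = RC (a d) by rewrite oppr0.
have zz : z * z^*%C = 1 by apply: unit_conjc.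
have E : v i ^+ (d + m - b) = v i ^+ m * v i ^+ d * z^*%C.
  rewrite -exprD -[LHS]mulr1 -zz mulrA -(vb i) -exprD; congr (_ ^+ _ * _).
  by move: dm; lia.
rewrite E.
transitivity (RC (a d) * RC (a (d + m)) * z^*%C * v i ^+ m * (v i ^+ d * (v i)^*%C ^+ d)).
  by ring.
by rewrite -exprMn vv expr1n mulr1.
Qed.

Let a01 d : 0 <= a d <= 1.
Proof. by rewrite /a; case: (d != d0); rewrite ?lexx ?ler01. Qed.

Let aa_le1 d d' : 0 <= a d * a d' <= 1.
Proof.
have /andP[x0 x1] := a01 d; have /andP[y0 y1] := a01 d'.
by rewrite mulr_ge0 //= mulr_ile1.
Qed.

Let sum_lt (m : 'I_b) : \sum_(d < b | (d + m < b)%N) 1 = b%:R - m%:R :> R.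
Proof.
rewrite sumr_const -natrB 1?ltnW //; congr (_%:R).
have E : (b - m <= b)%N by apply: leq_subr.
transitivity #|'I_(b - m)|; last by rewrite card_ord.
have inj : injective (widen_ord E) by move=> x y /(congr1 val) /= /val_inj.
rewrite -(fintype.card_image inj); apply: eq_card => d; rewrite unfold_in.
apply/idP/fintype.imageP => [dm|[x _ ->]] /=.
  have dm' : (d < b - m)%N by lia.
  by exists (Ordinal dm') => //; apply: val_inj.
by have := ltn_ord x; lia.
Qed.

Let sum_ge (m : 'I_b) : \sum_(d < b | ~~ (d + m < b)%N) 1 = m%:R :> R.
Proof.
have : \sum_(d < b) 1 = b%:R :> R by rewrite sumr_const card_ord.
by rewrite (bigID (fun d : 'I_b => (d + m < b)%N)) /= sum_lt; lra.
Qed.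

(** The product [a d * a (d + m)] vanishes for at most two [d], namely [d0] and [d0 - m]. *)
Let partial_sum_ge (P : pred 'I_b) (m : 'I_b) :
  \sum_(d < b | P d) 1 - 2 <= \sum_(d < b | P d) a d * a (d + m)%R.
Proof.
have one (x : 'I_b) : \sum_(d < b | P d) ((d == x)%:R : R) <= 1.
  apply: le_trans (_ : \sum_(d < b) ((d == x)%:R : R) <= _).
    by rewrite [leRHS](bigID P) /= lerDl sumr_ge0.
  rewrite (bigD1 x) //= eqxx big1 ?addr0 // => d /negbTE -> //.
have := one d0; have := one (d0 - m) => o1 o2.
suff : \sum_(d < b | P d) 1 <= \sum_(d < b | P d) a d * a (d + m)%R +
    \sum_(d < b | P d) ((d == d0)%:R : R) + \sum_(d < b | P d) ((d == d0 - m)%:R : R).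
  by lra.
rewrite -!big_split /=; apply: ler_sum => d _; rewrite /a.
have -> : (d == d0 - m) = (d + m == d0) by rewrite eq_sym subr_eq eq_sym.
by case: (d == d0); case: (d + m == d0);
  rewrite /= ?mulr0n ?mulr1n ?mul0r ?mulr0 ?mulr1; lra.
Qed.

(** With [w = b - 2 m] one has [|h m| >= |w| - 2]. The minorant comes from [b (|w| - 2) ^ 2 - (b -
    4) (w ^ 2 - b) = (2 |w| - b) ^ 2]; being quadratic in [m], it has an explicit sum. *)
Let cmod_h_ge (m : 'I_b) : (4 <= b)%N ->
  (b%:R - 4) * (b%:R - 2 * m%:R) ^+ 2 - b%:R * (b%:R - 4) <= b%:R * cmod (h m) ^+ 2.
Proof.
move=> b4; have p1 : b%:R - m%:R - 2 <= p m by rewrite -sum_lt partial_sum_ge.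
have q1 : m%:R - 2 <= q m by rewrite -sum_ge partial_sum_ge.
have p2 : p m <= b%:R - m%:R.
  by rewrite -sum_lt; apply: ler_sum => d _; have /andP[] := aa_le1 d (d + m).
have q2 : q m <= m%:R.
  by rewrite -sum_ge; apply: ler_sum => d _; have /andP[] := aa_le1 d (d + m).
have p0 : 0 <= p m by apply: sumr_ge0 => d _; have /andP[] := aa_le1 d (d + m).
have q0 : 0 <= q m by apply: sumr_ge0 => d _; have /andP[] := aa_le1 d (d + m).
have cz : cmod z^*%C = 1 by rewrite cmod_conjc z1.
have hge1 : p m - q m <= cmod (h m).
  rewrite lerBlDr; have -> : q m = cmod (RC (- q m) * z^*%C).
    by rewrite cmodM cz mulr1 rmorphN -mulN1r cmodM cmod_real // cmodE /= oppr0 expr0n addr0 sqrrN expr1n sqrtr1 mul1r.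
  rewrite -{1}(cmod_real p0).
  by apply: le_trans (cmodD _ _); rewrite /h rmorphN mulNr addrK.
have hge2 : q m - p m <= cmod (h m).
  rewrite lerBlDr; have -> : p m = cmod (RC (- p m)).
    by rewrite rmorphN -mulN1r cmodM cmod_real // cmodE /= oppr0 expr0n addr0 sqrrN expr1n sqrtr1 mul1r.
  have -> : q m = cmod (RC (q m) * z^*%C) by rewrite cmodM cz mulr1 cmod_real.
  by apply: le_trans (cmodD _ _); rewrite /h rmorphN addrAC subrr add0r.
have h0 := cmod_ge0 (h m).
have B1 : 4 <= b%:R :> R by rewrite ler_nat.
move: hge1 hge2 h0 p1 q1 p2 q2 B1; move: (cmod (h m)) (p m) (q m) => c x y.
set B : R := b%:R; set t : R := m%:R => h1 h2 c0 p1 q1 p2 q2 B4.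
have [w l1 l2] : exists2 w, B - 2 * t = w & w - 2 <= c /\ - w - 2 <= c.
  by exists (B - 2 * t) => //; lra.
rewrite l1; case: l2 => w1 w2 {h1 h2 p1 q1 p2 q2 p0 q0 l1}.
have [w_ge|w_lt] := lerP 2 w.
  have : 0 <= (2 * w - B) ^+ 2 by apply: sqr_ge0.
  have : (w - 2) ^+ 2 <= c ^+ 2 by rewrite lerXn2r ?nnegrE //; lra.
  by nra.
have [w_le|w_gt] := lerP w (-2).
  have : 0 <= (2 * w + B) ^+ 2 by apply: sqr_ge0.
  have : (- w - 2) ^+ 2 <= c ^+ 2 by rewrite lerXn2r ?nnegrE //; lra.
  by nra.
(* For [|w| < 2] the minorant is at most [(b - 4) (4 - b) <= 0]. *)
have : w ^+ 2 <= 4 by nra.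
have := sqr_ge0 c; nra.
Qed.

(** Parseval applied to [|dsum D v| ^ 2]. The coefficient [h 0] is exactly [b - 1], [cmod_h_ge]
    bounds the others, and the squares [(b - 2 m) ^ 2] are summed in closed form. *)
Lemma fourth_moment_ge : (4 <= b)%N ->
  b%:R * ((b%:R - 1) ^+ 2 + (b%:R - 1) * (b%:R - 4) * (b%:R - 5) / 3) <=
  \sum_(i < b) (cmod (dsum D (v i)) ^+ 2) ^+ 2.
Proof.
move=> b4; have -> : \sum_(i < b) (cmod (dsum D (v i)) ^+ 2) ^+ 2 =
    b%:R * \sum_(m < b) cmod (h m) ^+ 2.
  rewrite -parseval; apply: eq_bigr => i _; congr (_ ^+ 2).
  by rewrite -sqr_dsumE cmod_real ?exprn_ge0 ?cmod_ge0.
have b0 : 0 < b%:R :> R by [].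
rewrite ler_pM2l // big_ord_recl lerD //.
  have -> : h ord0 = RC (b%:R - 1).
    rewrite /h /q big1 ?mul0r ?addr0; last first.
      by move=> d; rewrite addn0 ltn_ord.
    congr RC; rewrite /p.
    rewrite (eq_bigl xpredT) => [|d]; last by rewrite addn0 ltn_ord.
    have -> : b%:R - 1 = (#|D|)%:R :> R by rewrite cardC1_ord /= -natr1 addrK.
    rewrite -sum1_card natr_sum [RHS]big_mkcond /=.
    by apply: eq_bigr => m _; rewrite addr0 /a !inE; case: (m != d0); rewrite ?mulr1 ?mulr0.
  by rewrite cmod_real // subr_ge0 ler1n.
rewrite -(ler_pM2l b0) mulr_sumr.
apply: le_trans (ler_sum _ (fun i _ => cmod_h_ge (lift ord0 i) b4)).
rewrite sumrB sumr_const card_ord -mulr_sumr.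
have sumsq (n : nat) (c : R) : \sum_(i < n) (c - 2 * (lift ord0 i : 'I_n.+1)%:R) ^+ 2 =
   n%:R * c ^+ 2 - 2 * c * n%:R * (n%:R + 1) + 2 / 3 * n%:R * (n%:R + 1) * (2 * n%:R + 1).
  transitivity (\sum_(i < n) (c - 2 * i.+1%:R) ^+ 2); first exact: eq_bigr.
  elim: n => [|n IH]; first by rewrite big_ord0; ring.
  by rewrite big_ord_recr /= IH -!natr1; field.
rewrite sumsq -[_ *+ b']mulr_natr -natr1.
set n : R := b'%:R; by rewrite le_eqVlt; apply/orP; left; apply/eqP; field.
Qed.
End Moments.

(** The weight is constant. [le_quartic] with [s1 = b - 1] is summed over the roots; the second
    moment is exact, and the fourth is bounded below because it enters with a minus sign. *)
Lemma subsolution_large (R : realType) b (d0 : 'I_b) : (13 <= b)%N ->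
  exists om lam : R, [/\ -1/2 <= om <= 1/2, 0 <= lam,
    lam <= 998 / 1000 * (b.-1%:R * Num.sqrt b%:R) & subsolution [set~ d0]%SET om lam].
Proof.
move=> b13; case: b d0 b13 => // b' d0 b13; set b := b'.+1.
have [th thE] : exists th : R, th = 998 / 1000 by eexists.
rewrite -thE; exists 0, (th * (b'%:R * Num.sqrt b%:R)).
have X0 : 0 <= b'%:R * Num.sqrt b%:R :> R by rewrite mulr_ge0 ?sqrtr_ge0.
have th0 : 0 <= th by lra.
split; [by apply/andP; split; lra|exact: mulr_ge0|exact: lexx|].
move=> u u1; rewrite mul0r addr0 mulr1.
have -> : \sum_(i < b) cmod (dsum [set~ d0]%SET (u * zroot R b ^+ i)) *
    (1 + 0 * Re (u * zroot R b ^+ i)) = \sum_(i < b) cmod (dsum [set~ d0]%SET (u * zroot R b ^+ i)).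
  by apply: eq_bigr => i _; rewrite mul0r addr0 mulr1.
have bE : b'%:R = b%:R - 1 :> R by rewrite -natr1 addrK.
have B13 : 13 <= b%:R :> R by rewrite ler_nat.
pose r : R := Num.sqrt b%:R; have r0 : 0 <= r by apply: sqrtr_ge0.
have r2 : r ^+ 2 = b%:R by rewrite sqr_sqrtr.
(* The tangent of the square root at 16. *)
have rle : r <= b%:R / 8 + 2 by have := sqr_ge0 (r - 4); nra.
(* The touching point of the quartic is put slightly below the root mean square [sqrt (b - 1)] of
   the moduli. *)
pose s0 := 17 / 20 * r.
have s00 : 0 < s0 by rewrite mulr_gt0 ?divr_gt0 // sqrtr_gt0.
pose K := (s0 + (b%:R - 1)) ^+ 2.
have K0 : 0 < K by rewrite exprn_gt0 //; lra.
pose f i := cmod (dsum [set~ d0]%SET (u * zroot R b ^+ i)).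
have step i : 2 * s0 * K * f i <= K * (s0 ^+ 2 + f i ^+ 2) - (f i ^+ 2 - s0 ^+ 2) ^+ 2.
  apply: le_quartic => //; last exact: ltW.
  rewrite cmod_ge0 /= (le_trans (cmod_dsum_le _ _)) ?cardC1_ord -?bE //.
  by rewrite cmodM u1 cmod_zrootX mulr1.
have S2 := second_moment u1 d0.
have S4 := @fourth_moment_ge R b' u u1 d0 (leq_trans (isT : (4 <= 13)%N) b13).
have P0 : 0 < 2 * s0 * K by apply: mulr_gt0 K0; lra.
rewrite -(ler_pM2l P0) mulr_sumr.
rewrite (eq_bigr (fun i : 'I_b => 2 * s0 * K * f i)) //.
apply: (le_trans (ler_sum _ (fun (i : 'I_b) _ => step i))).
have -> : \sum_(i < b) (K * (s0 ^+ 2 + f i ^+ 2) - (f i ^+ 2 - s0 ^+ 2) ^+ 2) =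
  K * (b%:R * s0 ^+ 2 + \sum_(i < b) f i ^+ 2) -
  (\sum_(i < b) (f i ^+ 2) ^+ 2 - 2 * s0 ^+ 2 * \sum_(i < b) f i ^+ 2 + b%:R * s0 ^+ 4).
  have cst (x : R) : b%:R * x = \sum_(i < b) x by rewrite sumr_const card_ord mulr_natl.
  rewrite !cst mulrDr !mulr_sumr -sumrB -!big_split -sumrB /=; apply: eq_bigr => i _.
  by ring.
rewrite S2; move: S4; rewrite -/f; set S4 := \sum_(i < b) _.
have s0E : s0 ^+ 2 = 289 / 400 * b%:R by rewrite exprMn r2; field.
have s04 : s0 ^+ 4 = (289 / 400 * b%:R) ^+ 2 by rewrite -s0E; ring.
rewrite s04 s0E bE -/r.
have -> : 2 * s0 * K * (th * ((b%:R - 1) * r)) =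
    2 * (17 / 20) * (th) * b%:R * (b%:R - 1) * K by rewrite /s0 -r2; ring.
have Kle : K <= (177 / 160 * b%:R + 7 / 10) ^+ 2.
  rewrite lerXn2r ?nnegrE //; rewrite /s0; lra.
move: K K0 Kle {step P0} S4; set B : R := b%:R in B13 * => K K0 Kle S4 hS4.
have key : K * (289 / 400 * B + B - 1 - 2 * (17 / 20) * th * (B - 1)) <=
  (B - 1) ^+ 2 + (B - 1) * (B - 4) * (B - 5) / 3 - 289 / 200 * B * (B - 1) + (289 / 400) ^+ 2 * B ^+ 2.
  (* [212 / 125 = 1.696] is just below [2 (17 / 20) th = 1.6966]. *)
  have Yge : 212 / 125 * (B - 1) <= 2 * (17 / 20) * th * (B - 1).
    by apply: ler_wpM2r; lra.
  apply: le_trans (_ : K * (289 / 400 * B + B - 1 - 212 / 125 * (B - 1)) <= _).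
    by apply: ler_wpM2l; [exact: ltW|lra].
  apply: le_trans (_ : (177 / 160 * B + 7 / 10) ^+ 2 * (289 / 400 * B + B - 1 - 212 / 125 * (B - 1)) <= _).
    by apply: ler_wpM2r Kle; lra.
  (* After this shift the difference of the two sides is a cubic in [x] with nonnegative
     coefficients. *)
  have [x x0 ->] : exists2 x, 0 <= x & B = 13 + x by exists (B - 13); [lra|ring].
  have x2 : 0 <= x ^+ 2 by apply: sqr_ge0.
  have x3 : 0 <= x ^+ 3 by apply: exprn_ge0.
  lra.
have := ler_wpM2l (_ : 0 <= B) key; move=> /(_ ltac:(lra)) {}key.
lra.
Qed.

(** * Base four *)

Section BaseFour.
Variable R : realType.

Lemma zroot4 : zroot R 4 = Complex 0 1.
Proof.
by rewrite /zroot /expi (_ : 2 * pi / 4 = pi / 2 :> R) ?cos_pihalf ?sin_pihalf //; field.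
Qed.

Lemma cmod_three_terms (v : R[i]) : cmod v = 1 ->
  cmod (1 + v + v ^+ 2) = `|1 + 2 * Re v|.
Proof.
move=> v1; have vv := unit_conjc v1.
have -> : 1 + v + v ^+ 2 = v * real_complex R (1 + 2 * Re v).
  rewrite rmorphD rmorphM rmorph1 rmorph_nat /= -addcJ !mulrDr vv; ring.
by rewrite cmodM v1 mul1r cmodE /= expr0n addr0 sqrtr_sqr.
Qed.

Lemma cmod_dsum4 (d0 : 'I_4) (v : R[i]) : (d0 == 0 :> nat) || (d0 == 3 :> nat) ->
  cmod v = 1 -> cmod (dsum [set~ d0]%SET v) = `|1 + 2 * Re v|.
Proof.
move=> h v1; rewrite dsumC1 !big_ord_recr big_ord0 /= -!val_eqE /=.
case/orP: h => /eqP -> /=; rewrite -cmod_three_terms //.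
  rewrite -[RHS]mul1r -{1}v1 -cmodM; congr cmod; ring.
by congr cmod; ring.
Qed.

(** This is the joint contribution of the points [v] and [-v], with [c = Re v], under the weight
    [1 + Re v / 50]. *)
Lemma abs_pair_le (c : R) : `|1 + 2 * c| * (1 + c / 50) + `|1 - 2 * c| * (1 - c / 50) =
  if 1 / 2 <= `|c| then 101 / 25 * `|c| else 2 + 2 / 25 * c ^+ 2.
Proof.
case: (ger0P c) => c0; case: lerP => h.
- by rewrite (ger0_norm (_ : 0 <= 1 + 2 * c)) ?(ler0_norm (_ : 1 - 2 * c <= 0)); try lra; field.
- by rewrite !ger0_norm; try lra; field.
- by rewrite (ler0_norm (_ : 1 + 2 * c <= 0)) ?(ger0_norm (_ : 0 <= 1 - 2 * c)); try lra; field.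
- by rewrite !ger0_norm; try lra; field.
Qed.

(** At [u = 1] the moduli are 3, 1, 1, 1, with sum [6 = 3 sqrt 4], so a constant weight gains
    nothing. The weight [1 + Re v / 50] brings [lam] down to 5.95. *)
Lemma subsolution4 (d0 : 'I_4) : (d0 == 0 :> nat) || (d0 == 3 :> nat) ->
  subsolution [set~ d0]%SET (1 / 50 : R) (119 / 20).
Proof.
move=> h u u1; rewrite !big_ord_recr big_ord0 /= zroot4.
have I2 : ('i : R[i])%C ^+ 2 = -1 by rewrite sqr_i.
set I := ('i)%C : R[i] in I2 *.
have I3 : I ^+ 3 = - I by rewrite exprS I2 mulrN1.
have E (k : nat) : cmod (dsum [set~ d0]%SET (u * I ^+ k)) = `|1 + 2 * Re (u * I ^+ k)|.
  by apply: cmod_dsum4 => //; rewrite cmodM u1 cmodX cmodE /= expr0n add0r expr1n sqrtr1 expr1n mulr1.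
rewrite !E expr0 expr1 I2 I3 add0r mulr1 mulrN1 mulrN.
have uR : u ^+ 4 = u * u * (u * u) by ring.
have reI : Re (u * I) = - Im u by rewrite ReM /=; ring.
have reN (x : R[i]) : Re (- x) = - Re x by case: x.
rewrite uR !reN reI opprK !ReM !ImM.
have : Re u ^+ 2 + Im u ^+ 2 = 1 by rewrite -sqr_cmod u1 expr1n.
move: (Re u) (Im u) => c s {u u1 uR reI E} cs.
have := abs_pair_le c; have := abs_pair_le s.
rewrite !mulrN => hs hc.
have -> : `|1 + 2 * c| * (1 + 1 / 50 * c) + `|1 - 2 * s| * (1 - 1 / 50 * s) +
  `|1 - 2 * c| * (1 - 1 / 50 * c) + `|1 + 2 * s| * (1 + 1 / 50 * s) =
  (`|1 + 2 * c| * (1 + c / 50) + `|1 - 2 * c| * (1 - c / 50)) +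
  (`|1 + 2 * s| * (1 + s / 50) + `|1 - 2 * s| * (1 - s / 50)) by field.
rewrite hs hc {hs hc}.
have -> : 119 / 20 * (1 + 1 / 50 * ((c * c - s * s) * (c * c - s * s) -
  (c * s + s * c) * (c * s + s * c))) =
  119 / 20 * (1 + 1 / 50 * ((c ^+ 2 + s ^+ 2) ^+ 2 - 8 * c ^+ 2 * s ^+ 2)) by field.
rewrite cs -(real_normK (num_real c)) -(real_normK (num_real s)).
move: cs; rewrite -(real_normK (num_real c)) -(real_normK (num_real s)).
move: (normr_ge0 c) (normr_ge0 s); move: `|c| `|s| => p q => p0 q0 pq.
have mixed (x y : R) : x ^+ 2 + y ^+ 2 = 1 -> 0 <= x -> 0 <= y -> y < 1 / 2 ->
    101 / 25 * x + (2 + 2 / 25 * y ^+ 2) <= 119 / 20 * (1 + 1 / 50 * (1 ^+ 2 - 8 * x ^+ 2 * y ^+ 2)).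
  move=> xy x0 y0 y1.
  have xE : x ^+ 2 = 1 - y ^+ 2 by lra.
  have xle : x <= 1 - y ^+ 2 / 2 by have := sqr_ge0 (x - 1); lra.
  have y2 : 0 <= y ^+ 2 by apply: sqr_ge0.
  have y4 : 0 <= (y ^+ 2) ^+ 2 by apply: sqr_ge0.
  rewrite xE; lra.
case: (lerP (1 / 2) p) => p2; case: (lerP (1 / 2) q) => q2.
- have m0 : 0 <= p * q by apply: mulr_ge0.
  have m1 : p * q <= 1 / 2 by have := sqr_ge0 (p - q); lra.
  (* Tangent bound at 7/5, using [(p + q) ^ 2 = 1 + 2 p q]. *)
  have sle : p + q <= 37 / 35 + 5 / 7 * (p * q) by have := sqr_ge0 (p + q - 7 / 5); lra.
  have m2 : (p * q) * (p * q) <= 1 / 2 * (p * q) by apply: ler_wpM2r.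
  have -> : 8 * p ^+ 2 * q ^+ 2 = 8 * ((p * q) * (p * q)) by ring.
  by rewrite expr1n; lra.
- exact: mixed.
- have qp : q ^+ 2 + p ^+ 2 = 1 by rewrite addrC.
  have := mixed q p qp q0 p0 p2.
  have -> : 8 * q ^+ 2 * p ^+ 2 = 8 * p ^+ 2 * q ^+ 2 by ring.
  by rewrite addrC.
- by exfalso; clear - p0 q0 pq p2 q2; nra.
Qed.

End BaseFour.

Lemma exists_subsolution (R : realType) b (d0 : 'I_b) :
  (5 <= b)%N \/ b = 4 /\ (d0 == 0 :> nat) || (d0 == 3 :> nat) ->
  exists om lam : R, [/\ -1/2 <= om <= 1/2, 0 <= lam,
    lam <= 998 / 1000 * (b.-1%:R * Num.sqrt b%:R) & subsolution [set~ d0]%SET om lam].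
Proof.
move=> [b5|[b4 h]].
  have [b12|b13] := leqP b 12; first by apply: subsolution_small; rewrite b5.
  exact: subsolution_large.
move: d0 h; rewrite b4 => d0 h; exists (1 / 50), (119 / 20).
split; [by apply/andP; split; lra|lra| |exact: subsolution4].
have -> : Num.sqrt 4 = 2 :> R by rewrite -[2]ger0_norm // -sqrtr_sqr expr2 -natrM.
rewrite /=; lra.
Qed.

(** * Exponential sums and counting *)

(** Words grow at the low end, so that [expsumS] splits off one digit and replaces [v] by
    [v ^ b]. *)
Fixpoint digit_words b (D : {set 'I_b}) (k : nat) : seq nat :=
  if k is k'.+1 then
    [seq (nat_of_ord d + b * a)%N | d <- enum D, a <- digit_words D k']
  else [:: 0%N].

Section ExponentialSums.
Variables (R : realType) (b : nat) (D : {set 'I_b}).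
Implicit Types (v : R[i]) (k : nat).

Lemma size_digit_words k : size (digit_words D k) = (#|D| ^ k)%N.
Proof. by elim: k => //= k IH; rewrite size_allpairs IH -cardE expnS. Qed.

Definition expsum k v : R[i] := \sum_(a <- digit_words D k) v ^+ a.

Lemma expsumS k v : expsum k.+1 v = dsum D v * expsum k (v ^+ b).
Proof.
rewrite /expsum /= big_allpairs_dep /= /dsum -big_enum mulr_suml /=.
apply: eq_bigr => d _; rewrite mulr_sumr; apply: eq_bigr => a _.
by rewrite exprD exprM.
Qed.

Lemma cmod_expsum_conj k v : cmod (expsum k v^*%C) = cmod (expsum k v).
Proof.
rewrite -[RHS]cmod_conjc /expsum rmorph_sum; congr cmod.
by apply: eq_bigr => a _; rewrite rmorphXn.
Qed.

Lemma expsum1 k : cmod (expsum k 1) = (#|D| ^ k)%:R.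
Proof.
rewrite /expsum; under eq_bigr do rewrite expr1n.
by rewrite big_const_seq count_predT size_digit_words iter_addr_0 cmod_nat.
Qed.

(** By [expsumS] the weighted sum over the roots of unity, grouped by their [b]-th powers, is one
    step of the transfer operator, so each digit costs a factor [lam]. The 3 is the quotient of the
    bounds 3/2 and 1/2 of the weight. *)
Lemma expsum_l1 (om lam : R) k : (0 < b)%N -> -1/2 <= om <= 1/2 -> 0 <= lam ->
  subsolution D om lam ->
  \sum_(r < b ^ k) cmod (expsum k (zroot R (b ^ k) ^+ r)) <= 3 * lam ^+ k.
Proof.
move=> b0 /andP[om1 om2] lam0 sub.
have bk0 j : (0 < b ^ j)%N by rewrite expn_gt0 b0.
have H : \sum_(r < b ^ k) cmod (expsum k (zroot R (b ^ k) ^+ r)) *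
    (1 + om * Re (zroot R (b ^ k) ^+ r)) <= lam ^+ k * (1 + om).
  elim: k => [|k IH].
    by rewrite expn0 big_ord1 !expr0 mul1r expsum1 expn0 mul1r /= mulr1.
  rewrite expnS (sum_ord_mul (fun r => cmod (expsum k.+1 (zroot R (b * b ^ k) ^+ r)) *
    (1 + om * Re (zroot R (b * b ^ k) ^+ r)))) exchange_big /=.
  rewrite exprS -mulrA; apply: le_trans (ler_wpM2l lam0 IH); rewrite mulr_sumr.
  apply: ler_sum => r _.
  set u := zroot R (b * b ^ k) ^+ r.
  (* For fixed [r] the indices [i b ^ k + r] give the [b] points with the same [b]-th power. *)
  have vE i : zroot R (b * b ^ k) ^+ (i * b ^ k + r) = u * zroot R b ^+ i.
    by rewrite exprD [(i * _)%N]mulnC exprM zrootXMn // mulrC.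
  have ub : u ^+ b = zroot R (b ^ k) ^+ r.
    by rewrite /u -exprM [(r * b)%N]mulnC exprM [(b * _)%N]mulnC zrootXMn.
  have vb i : (u * zroot R b ^+ i) ^+ b = u ^+ b.
    by rewrite exprMn -[(zroot R b ^+ i) ^+ b]exprM [(i * b)%N]mulnC exprM zrootXn // expr1n mulr1.
  have u1 : cmod u = 1 by rewrite cmod_zrootX.
  rewrite -ub mulrCA; apply: le_trans (ler_wpM2l (cmod_ge0 _) (sub u u1)).
  rewrite mulr_sumr le_eqVlt; apply/orP; left; apply/eqP; apply: eq_bigr => i _.
  by rewrite vE expsumS vb cmodM; ring.
have half : 1 / 2 * \sum_(r < b ^ k) cmod (expsum k (zroot R (b ^ k) ^+ r)) <= 3 / 2 * lam ^+ k.
  apply: le_trans (_ : lam ^+ k * (1 + om) <= _); last first.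
    by rewrite mulrC; apply: ler_wpM2r; [apply: exprn_ge0|lra].
  apply: le_trans H; rewrite mulr_sumr; apply: ler_sum => r _.
  rewrite mulrC; apply: ler_wpM2l; first exact: cmod_ge0.
  have /andP[] := unit_Re_bounds (cmod_zrootX R (b ^ k) r); nra.
lra.
Qed.

End ExponentialSums.

(** * Counting words by a Fejer kernel *)

Section FejerCount.
Variables (R : realType) (b : nat) (D : {set 'I_b}) (k : nat).
Hypothesis b0 : (0 < b)%N.
Let N := (b ^ k)%N.
Let zN := zroot R N.
Let g (n : nat) : R := cmod (expsum D k (zN ^+ n)).

Let N0 : (0 < N)%N. Proof. by rewrite expn_gt0 b0. Qed.

Lemma cos_ge_half (x : R) : 0 <= x <= pi / 4 -> 1 / 2 <= cos x.
Proof.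
case/andP=> x0 x1; have pi0 := pi_gt0 R.
have c0 : 0 <= cos x by apply: cos_ge0_pihalf; apply/andP; split; lra.
have : 0 <= cos (x *+ 2).
  by apply: cos_ge0_pihalf; rewrite -[x *+ 2]mulr_natl; apply/andP; split; lra.
rewrite cos_mulr2n -[_ *+ 2]mulr_natl => h; nra.
Qed.

(** Modulo [N], [a q] is [-t] with [t <= T], so the angles [2 pi t j / N] are at most [pi / 4] and
    every term has real part at least 1/2. *)
Lemma fejer_ge (a q t p T J : nat) : (a * q + t = p * N)%N -> (t <= T)%N ->
  (8 * T * J <= N)%N ->
  J%:R / 2 <= cmod (\sum_(j < J) (zN ^+ (a * q)) ^+ j).
Proof.
move=> apt tT TJ; apply: le_trans (Re_le_cmod _); rewrite Re_sum.
have vE : zN ^+ (a * q) = (zN ^+ t)^*%C.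
  have t1 := unit_conjc (cmod_zrootX R N t).
  have : zN ^+ (a * q) * zN ^+ t = 1.
    by rewrite -exprD apt mulnC exprM zrootXn // expr1n.
  move=> /(congr1 (fun x => x * (zN ^+ t)^*%C)).
  by rewrite -mulrA t1 mulr1 mul1r.
have -> : J%:R / 2 = \sum_(j < J) (1 / 2 : R).
  by rewrite sumr_const card_ord -[RHS]mulr_natl mul1r.
apply: ler_sum => j _.
have -> : Re ((zN ^+ (a * q)) ^+ j) = cos (2 * pi / N%:R *+ (t * j)).
  have -> : (zN ^+ (a * q)) ^+ j = ((zN ^+ t) ^+ j)^*%C by rewrite vE -rmorphXn.
  by rewrite conjcE /= -exprM /zN /zroot -expiMn.
apply: cos_ge_half; rewrite -[_ *+ _]mulr_natr; have pi0 := pi_gt0 R.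
have NR : 0 < N%:R :> R by rewrite ltr0n.
apply/andP; split.
  by apply: mulr_ge0 => //; apply: divr_ge0; [apply: mulr_ge0 => //; apply: ltW|].
rewrite mulrAC ler_pdivrMr //.
have : ((t * j)%:R * 8 <= N%:R :> R).
  by rewrite -natrM ler_nat (leq_trans _ TJ) //; have := leq_mul tT (ltnW (ltn_ord j)); lia.
move=> h; nra.
Qed.

Let dist (i j : nat) := ((i - j) + (j - i))%N.

(** Every distance to [j] occurs at most twice. *)
Lemma sum_dist (G : nat -> R) (J j : nat) : (forall n, 0 <= G n) -> (j < J)%N ->
  \sum_(i < J) G (dist j i) <= 2 * \sum_(s < J) G s.
Proof.
move=> G0 jJ; rewrite -(big_mkord xpredT (fun i => G (dist j i))).
rewrite (big_cat_nat (n := j)) ?(ltnW jJ) //= -(big_mkord xpredT G).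
rewrite [2 * _]mulr_natl mulr2n; apply: lerD.
  rewrite big_nat_rev /= add0n.
  apply: le_trans (_ : \sum_(1 <= i < j.+1) G i <= _).
    rewrite big_add1 /= le_eqVlt; apply/orP; left; apply/eqP.
    by apply: eq_big_nat => i /andP[_ ij]; congr G; rewrite /dist; lia.
  rewrite [leRHS](big_cat_nat (n := 1)) ?(leq_ltn_trans _ jJ) //=.
  rewrite [X in _ <= _ + X](big_cat_nat (n := j.+1)) //=.
  have : 0 <= \sum_(0 <= i < 1) G i by apply: sumr_ge0.
  have : 0 <= \sum_(j.+1 <= i < J) G i by apply: sumr_ge0.
  lra.
rewrite -{1}[j]add0n big_addn.
rewrite [leRHS](big_cat_nat (n := (J - j)%N)) ?leq_subr //=.
rewrite [leLHS](_ : _ = \sum_(0 <= i < J - j) G i).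
  by rewrite lerDl; apply: sumr_ge0.
by apply: eq_big_nat => i _; congr G; rewrite /dist; lia.
Qed.

(** Expanding the square and summing over [a] first produces [expsum] at the differences
    [q (j - i)]; their sign only conjugates it. *)
Lemma fejer_sum_le (q J : nat) :
  \sum_(a <- digit_words D k) cmod (\sum_(j < J) (zN ^+ (a * q)) ^+ j) ^+ 2 <=
  2 * J%:R * \sum_(s < J) g (q * s).
Proof.
apply: le_trans (_ : \sum_(j < J) \sum_(i < J) g (q * dist j i) <= _); last first.
  have -> : 2 * J%:R * \sum_(s < J) g (q * s) = \sum_(j < J) 2 * \sum_(s < J) g (q * s).
    by rewrite sumr_const card_ord -mulr_natl; ring.
  apply: ler_sum => j _; apply: (sum_dist (G := fun n => g (q * n))) => // n.
  exact: cmod_ge0.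
have E (a : nat) : cmod (\sum_(j < J) (zN ^+ (a * q)) ^+ j) ^+ 2 =
    \sum_(j < J) \sum_(i < J) Re ((zN ^+ (q * j) * (zN ^+ (q * i))^*%C) ^+ a).
  transitivity (Re (real_complex R (cmod (\sum_(j < J) (zN ^+ (a * q)) ^+ j) ^+ 2))) => //.
  rewrite -mul_conjc rmorph_sum mulr_suml Re_sum; apply: eq_bigr => j _.
  rewrite mulr_sumr Re_sum; apply: eq_bigr => i _; congr Re.
  rewrite exprMn -!rmorphXn /= -!exprM; congr (_ ^+ _ * (_ ^+ _)^*%C); ring.
rewrite (eq_bigr _ (fun a _ => E a)) exchange_big /=; apply: ler_sum => j _.
rewrite exchange_big /=; apply: ler_sum => i _.
rewrite -Re_sum; apply: le_trans (Re_le_cmod _) _.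
rewrite -[X in cmod X]/(expsum D k _).
have U m := unit_conjc (cmod_zrootX R N m).
have [ij|ji] := leqP i j.
  rewrite /g /dist (_ : j - i + (i - j) = j - i)%N; last by lia.
  have -> : zN ^+ (q * j) = zN ^+ (q * (j - i)) * zN ^+ (q * i).
    by rewrite -exprD -mulnDr subnK.
  by rewrite -mulrA U mulr1.
rewrite /g /dist (_ : j - i + (i - j) = i - j)%N; last by lia.
have -> : zN ^+ (q * i) = zN ^+ (q * (i - j)) * zN ^+ (q * j).
  by rewrite -exprD -mulnDr subnK // ltnW.
rewrite rmorphM /= mulrCA U mulr1.
by rewrite cmod_expsum_conj.
Qed.

(** The terms with [s = 0] give [T |D| ^ k]. Otherwise [n = q s] lies strictly between 0 and [N],
    and it arises at most once for each divisor [q] of [n]. *)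
Lemma sum_divisor_le (T J : nat) (M : R) : (T * J <= N)%N -> 0 <= M ->
  (forall n, (0 < n < N)%N -> (size (divisors n))%:R <= M) ->
  \sum_(q < T) \sum_(s < J) g (q.+1 * s) <=
  T%:R * (#|D| ^ k)%:R + M * \sum_(n < N) g n.
Proof.
move=> TJ M0 hM.
case: J TJ => [|J] TJ.
  rewrite big1 => [|q _]; last by rewrite big_ord0.
  by rewrite addr_ge0 ?mulr_ge0 // sumr_ge0 // => n _; apply: cmod_ge0.
have -> : \sum_(q < T) \sum_(s < J.+1) g (q.+1 * s) =
    T%:R * (#|D| ^ k)%:R + \sum_(q < T) \sum_(s < J) g (q.+1 * s.+1).
  have g0 : g 0 = (#|D| ^ k)%:R by rewrite /g expr0 expsum1.
  under eq_bigr do rewrite big_ord_recl muln0 g0.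
  by rewrite big_split /= sumr_const card_ord -[_ *+ T]mulr_natl.
rewrite lerD2l mulr_sumr.
have lt (q : 'I_T) (s : 'I_J) : (q.+1 * s.+1 < N)%N.
  apply: leq_trans TJ; have := ltn_ord q; have := ltn_ord s => h1 h2; nia.
have gE (q : 'I_T) (s : 'I_J) : g (q.+1 * s.+1) =
    \sum_(n < N) (n == q.+1 * s.+1 :> nat)%N%:R * g n.
  rewrite (bigD1 (Ordinal (lt q s))) //= eqxx mul1r big1 ?addr0 // => n.
  by rewrite -val_eqE /= => /negbTE ->; rewrite mul0r.
under eq_bigr do under eq_bigr do rewrite gE.
under eq_bigr do rewrite exchange_big /=.
rewrite exchange_big /=; apply: ler_sum => n _.
under eq_bigr do rewrite -mulr_suml.
rewrite -mulr_suml; apply: ler_wpM2r; first exact: cmod_ge0.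
have [n0|n0] := posnP n.
  by rewrite n0 big1 // => q _; rewrite big1.
apply: le_trans (hM n _); last by rewrite n0 ltn_ord.
apply: le_trans (_ : \sum_(q < T) (q.+1 %| n)%N%:R <= _).
  apply: ler_sum => q _; have [dv|ndv] := boolP (q.+1 %| n)%N; last first.
    rewrite big1 // => s _; case: eqP => // E; move: ndv.
    by rewrite E dvdn_mulr.
  case/dvdnP: dv => c cE.
  have [cJ|Jc] := leqP c.-1.+1 J.
    rewrite (bigD1 (Ordinal cJ)) //= big1 ?addr0; first by case: (_ == _).
    move=> s; rewrite -val_eqE /= => sc; case: eqP => // E; move: sc.
    have c0 : (0 < c)%N by lia.
    suff -> : c = s.+1 by rewrite eqxx.
    by apply/eqP; rewrite -(eqn_pmul2r (ltn0Sn q)) -cE E mulnC.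
  rewrite big1 // => s _; case: eqP => // E.
  have : c = s.+1 by apply/eqP; rewrite -(eqn_pmul2r (ltn0Sn q)) -cE E mulnC.
  by have := ltn_ord s; lia.
rewrite -natr_sum ler_nat.
rewrite -(big_mkord xpredT (fun q => (q.+1 %| n)%N : nat)) -big_mkcond /=.
rewrite sum1_count -size_filter -(size_map S).
apply: uniq_leq_size.
  by rewrite map_inj_uniq ?filter_uniq ?iota_uniq // => x y [].
move=> x /mapP[y]; rewrite mem_filter => /andP[dv _] ->.
by rewrite -dvdn_divisors.
Qed.

(** Each [a] in [B] has a denominator at which the squared kernel is at least [J ^ 2 / 4]; this is
    compared with the upper bound for the sum over all words and denominators. *)
Lemma fejer_count (T J : nat) (M : R) (B : seq nat) :
  (0 < J)%N -> (8 * T * J <= N)%N -> 0 <= M ->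
  (forall n, (0 < n < N)%N -> (size (divisors n))%:R <= M) ->
  uniq B -> {subset B <= digit_words D k} ->
  (forall a, a \in B -> exists q t p,
     [/\ (q < T)%N, (t <= T)%N & (a * q.+1 + t = p * N)%N]) ->
  (size B)%:R <= 8 / J%:R * (T%:R * (#|D| ^ k)%:R + M * \sum_(n < N) g n).
Proof.
move=> J0 TJ M0 hM uB sB hB.
pose F a q := cmod (\sum_(j < J) (zN ^+ (a * q)) ^+ j) ^+ 2.
have F0 a q : 0 <= F a q by apply: sqr_ge0.
have JR : 0 < J%:R :> R by rewrite ltr0n.
have h1 a : a \in B -> J%:R ^+ 2 / 4 <= \sum_(q < T) F a q.+1.
  case/hB=> q [t [p [qT tT apt]]]; rewrite (bigD1 (Ordinal qT)) //=.
  have := fejer_ge apt tT TJ => h.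
  have : (J%:R / 2) ^+ 2 <= F a q.+1.
    by rewrite /F lerXn2r ?nnegrE ?cmod_ge0 // divr_ge0 // ltW.
  have : 0 <= \sum_(i < T | i != Ordinal qT) F a i.+1 by apply: sumr_ge0.
  by rewrite exprMn; lra.
have h2 : (size B)%:R * (J%:R ^+ 2 / 4) <= \sum_(a <- digit_words D k) \sum_(q < T) F a q.+1.
  apply: le_trans (_ : \sum_(a <- B) \sum_(q < T) F a q.+1 <= _).
    have -> : (size B)%:R * (J%:R ^+ 2 / 4) = \sum_(a <- B) (J%:R ^+ 2 / 4) :> R.
      by rewrite big_const_seq count_predT iter_addr_0 mulr_natl.
    rewrite big_seq [leRHS]big_seq; apply: ler_sum; exact: h1.
  (* As [B] has no repetitions, it is up to permutation a subsequence of the words, and the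
     remaining terms are nonnegative. *)
  have /count_subseqP[s ss Bs] : forall x, (count_mem x B <= count_mem x (digit_words D k))%N.
    exact: leq_uniq_count.
  have [c /(perm_big _) -> /=] := perm_to_subseq ss.
  by rewrite big_cat /= (perm_big _ Bs) lerDl; apply: sumr_ge0 => a _; apply: sumr_ge0.
have h3 : \sum_(a <- digit_words D k) \sum_(q < T) F a q.+1 <=
    2 * J%:R * (T%:R * (#|D| ^ k)%:R + M * \sum_(n < N) g n).
  rewrite exchange_big /=.
  apply: le_trans (ler_sum _ (fun (q : 'I_T) _ => fejer_sum_le q.+1 J)) _.
  rewrite -mulr_sumr; apply: ler_wpM2l; first by rewrite mulr_ge0 // ltW.
  apply: sum_divisor_le => //; apply: leq_trans TJ; rewrite -mulnA.
  by apply: leq_pmull.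
move: h3; set X := T%:R * _ + _ => h3.
have X2 : (size B)%:R * (J%:R ^+ 2 / 4) <= 2 * J%:R * X by apply: le_trans h3.
rewrite mulrAC ler_pdivlMr // -(ler_pM2r JR).
rewrite -(ler_pM2r (_ : 0 < 1 / 4)); last by lra.
by apply: le_trans (_ : 2 * J%:R * X <= _); lra.
Qed.
End FejerCount.

(** * Number of divisors *)

(** A divisor is determined by its [p]-adic valuation and its part prime to [p]. *)
Lemma size_divisors_part (p n : nat) : prime p -> (0 < n)%N ->
  (size (divisors n) <= (logn p n).+1 * size (divisors n`_p^'))%N.
Proof.
move=> pp n0.
rewrite -[X in (_ <= X * _)%N](size_iota 0) -(size_allpairs (fun i e => p ^ i * e)%N).
apply: uniq_leq_size; first exact: divisors_uniq.
move=> x; rewrite -dvdn_divisors // => xn.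
have x0 : (0 < x)%N by apply: dvdn_gt0 xn.
apply/allpairsP; exists (logn p x, x`_p^')%N; split.
- by rewrite mem_iota add0n ltnS; apply: dvdn_leq_log.
- by rewrite -dvdn_divisors ?part_gt0 // partn_dvd.
- by rewrite -p_part partnC.
Qed.

Section DivisorBound.
Variables (R : realType) (eps : R).
Hypothesis eps0 : 0 < eps.

Lemma powR_natX (p v : nat) : (p ^ v)%:R `^ eps = (p%:R `^ eps) ^+ v :> R.
Proof.
elim: v => [|v IH]; first by rewrite expn0 expr0 powR1.
by rewrite expnS natrM powRM // IH exprS.
Qed.

Lemma powR_natpart (p n : nat) : (0 < n)%N ->
  n%:R `^ eps = (p%:R `^ eps) ^+ logn p n * (n`_p^')%N%:R `^ eps :> R.
Proof. by move=> n0; rewrite -{1}(partnC p n0) natrM powRM // p_part powR_natX. Qed.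

Let rough (j n : nat) := forall p, prime p -> (p %| n)%N -> (j <= p)%N.

(** If [p >= 2 ^ (1 / eps)] then [v + 1 <= 2 ^ v <= p ^ (eps v)], so large primes cost no
    constant. *)
Lemma divisor_bound_rough : exists P, forall n, (0 < n)%N -> rough P n ->
  (size (divisors n))%:R <= n%:R `^ eps :> R.
Proof.
pose P := `|Num.ceil (2 `^ eps^-1 : R)|%N.
have P2 (p : nat) : (P <= p)%N -> 2 <= p%:R `^ eps :> R.
  move=> Pp; have le : 2 `^ eps^-1 <= p%:R :> R.
    apply: le_trans (_ : P%:R <= _); last by rewrite ler_nat.
    apply: le_trans (ceil_ge _) _.
    rewrite /P natr_absz ler_int; exact: ler_norm.
  have -> : 2 = (2 `^ eps^-1) `^ eps :> R.
    by rewrite -powRrM mulVf ?gt_eqF // powRr1.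
  by apply: ge0_ler_powR; rewrite ?nnegrE ?powR_ge0 ?ler0n // ltW.
exists P => n; elim/ltn_ind: n => n IH n0 rn.
have [n1|n1] := leqP n 1.
  have -> : n = 1%N by lia.
  by rewrite powR1.
set p := pdiv n; have pp : prime p by apply: pdiv_prime.
have pn : (p %| n)%N by apply: pdiv_dvd.
have v1 : (0 < logn p n)%N by rewrite logn_gt0 mem_primes pp n0.
have m0 : (0 < n`_p^')%N by apply: part_gt0.
have mn : (n`_p^' < n)%N.
  rewrite -{2}(partnC p n0) p_part ltn_Pmull // -(exp1n (logn p n)) ltn_exp2r //.
  exact: prime_gt1.
have rm : rough P (n`_p^')%N.
  by move=> r rp rd; apply: rn => //; apply: dvdn_trans rd (dvdn_part _ _).
have := IH _ mn m0 rm => IHm.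
apply: le_trans (_ : ((logn p n).+1 * size (divisors n`_p^'))%N%:R <= _).
  by rewrite ler_nat size_divisors_part.
rewrite natrM (powR_natpart p n0); apply: ler_pM => //.
apply: le_trans (_ : 2 ^+ logn p n <= _).
  by rewrite -natrX ler_nat ltn_expl.
by apply: lerXn2r; rewrite ?nnegrE ?powR_ge0 // P2 // rn.
Qed.

Lemma divisor_bound : exists2 C : R, 0 < C &
  forall n, (0 < n)%N -> (size (divisors n))%:R <= C * n%:R `^ eps.
Proof.
have [P hP] := divisor_bound_rough.
suff H j : exists2 C : R, 0 < C & forall n, (0 < n)%N -> rough (P - j) n ->
    (size (divisors n))%:R <= C * n%:R `^ eps.
  have [C C0 hC] := H P; exists C => // n n0; apply: hC => // p _ _.
  by rewrite subnn.
elim: j => [|j [C C0 hC]].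
  by exists 1 => // n n0; rewrite subn0 mul1r; apply: hP.
pose x : R := 2 `^ eps - 1.
have x0 : 0 < x.
  have e1 : 1 `^ eps = 1 by rewrite powR1.
  by rewrite subr_gt0 -[ltLHS]e1; apply: gt0_ltr_powR; rewrite ?nnegrE ?ltr1n.
pose C' := 1 + x^-1.
have C'1 : 1 <= C' by rewrite lerDl invr_ge0 ltW.
exists (C' * C); first by rewrite mulr_gt0 // (lt_le_trans _ C'1).
move=> n n0 rn; set p := (P - j.+1)%N.
have [/andP[pp pn]|npp] := boolP (prime p && (p %| n)%N); last first.
  apply: le_trans (hC n n0 _) _.
    move=> r rp rd; have := rn r rp rd; rewrite leq_eqVlt => /orP[/eqP E|]; last by lia.
    by move: npp; rewrite /p E rp rd.
  by rewrite -mulrA ler_peMl // mulr_ge0 ?powR_ge0 // ltW.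
have rm : rough (P - j) (n`_p^')%N.
  move=> r rp rd; have /(rn r rp) : (r %| n)%N by apply: dvdn_trans rd (dvdn_part _ _).
  rewrite -/p leq_eqVlt => /orP[/eqP E|]; last by rewrite /p; lia.
  have : pnat (negn p) (n`_p^')%N by apply: part_pnat.
  move/pnatP => /(_ (part_gt0 _ _) r rp rd).
  by rewrite -E !inE eqxx.
apply: le_trans (_ : ((logn p n).+1 * size (divisors n`_p^'))%N%:R <= _).
  by rewrite ler_nat size_divisors_part.
rewrite natrM (powR_natpart p n0).
have -> : C' * C * (p%:R `^ eps ^+ logn p n * (n`_p^')%N%:R `^ eps) =
  (C' * p%:R `^ eps ^+ logn p n) * (C * (n`_p^')%N%:R `^ eps) by ring.
apply: ler_pM => //; last by apply: hC => //; apply: part_gt0.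
apply: le_trans (_ : C' * (1 + x *+ logn p n) <= _).
  rewrite /C' -natr1 -[x *+ _]mulr_natl.
  have -> : (1 + x^-1) * (1 + (logn p n)%:R * x) =
    1 + (logn p n)%:R * x + x^-1 + (logn p n)%:R by field; rewrite gt_eqF.
  have : 0 <= (logn p n)%:R * x by rewrite mulr_ge0 // ltW.
  have : 0 <= x^-1 by rewrite invr_ge0 ltW.
  by lra.
apply: ler_wpM2l; first by rewrite (le_trans _ C'1).
apply: le_trans (_ : (1 + x) ^+ logn p n <= _).
  elim: (logn p n) => [|v IHv]; first by rewrite mulr0n addr0 expr0.
  rewrite exprS mulrS; apply: le_trans (ler_wpM2l _ IHv); last by lra.
  have : 0 <= x *+ v by rewrite mulrn_wge0 // ltW.
  nra.
apply: lerXn2r; rewrite ?nnegrE ?powR_ge0 //; first by lra.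
rewrite /x addrCA subrr addr0; apply: ge0_ler_powR; rewrite ?nnegrE ?ler_nat //.
  exact: ltW.
exact: prime_gt1.
Qed.

End DivisorBound.

(** * Digit expansions and Hausdorff dimension *)

Section DigitPrefixes.
Variables (R : realType) (b : nat).
Implicit Types (d : nat -> 'I_b).

Fixpoint prefix_nat d k : nat :=
  if k is k'.+1 then (b * prefix_nat d k' + d k')%N else 0%N.

Lemma prefix_nat_words (D : {set 'I_b}) d k : (forall n, d n \in D) ->
  prefix_nat d k \in digit_words D k.
Proof.
move=> dD; elim: k => [|k IH]; rewrite ?mem_seq1 //=.
by apply/allpairsP; exists (d k, prefix_nat d k); rewrite mem_enum dD IH addnC.
Qed.

Definition digit_series d : R^nat :=
  series (fun n => (d n : nat)%:R / b%:R ^+ n.+1 : R).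

Hypothesis b0 : (0 < b)%N.
Let bR : 0 < b%:R :> R. Proof. by rewrite ltr0n. Qed.
Let bX k : 0 < b%:R ^+ k :> R. Proof. exact: exprn_gt0. Qed.

Lemma digit_seriesE d k : digit_series d k = (prefix_nat d k)%:R / b%:R ^+ k.
Proof.
rewrite /digit_series /series /=; elim: k => [|k IH].
  by rewrite big_geq // mul0r.
rewrite big_nat_recr //= IH natrD natrM exprS; field.
by rewrite !gt_eqF.
Qed.

Lemma nondecreasing_digit_series d : nondecreasing_seq (digit_series d).
Proof.
apply/nondecreasing_seqP => n.
by rewrite /digit_series /series /= big_nat_recr //= lerDl divr_ge0 // ltW.
Qed.

(** The later digits add at most [b ^ (n - k) - 1]. *)
Lemma prefix_upper d k n : (k <= n)%N ->
  ((prefix_nat d n).+1 <= (prefix_nat d k).+1 * b ^ (n - k))%N.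
Proof.
elim: n => [|n IH]; first by rewrite leqn0 => /eqP ->; rewrite expn0 muln1.
rewrite leq_eqVlt => /orP[/eqP ->|kn]; first by rewrite subnn muln1.
rewrite subSn // expnS mulnCA.
have dn := ltn_ord (d n); have := leq_mul (leqnn b) (IH kn).
by move=> /=; lia.
Qed.

Lemma digit_series_le d k n : digit_series d n <= (prefix_nat d k).+1%:R / b%:R ^+ k.
Proof.
wlog kn : n / (k <= n)%N => [H|].
  have [|nk] := leqP k n; first exact: H.
  by apply: le_trans (H k (leqnn k)); apply: nondecreasing_digit_series; exact: ltnW.
have bn : b%:R ^+ n = b%:R ^+ (n - k) * b%:R ^+ k :> R by rewrite -exprD subnK.
rewrite digit_seriesE ler_pdivrMr // bn mulrCA divfK ?gt_eqF //.
by rewrite -natrX -natrM ler_nat mulnC; apply: leq_trans (prefix_upper d kn).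
Qed.

Lemma is_cvg_digit_series d : cvgn (digit_series d).
Proof.
apply: nondecreasing_is_cvgn; first exact: nondecreasing_digit_series.
by exists ((prefix_nat d 0).+1%:R / b%:R ^+ 0) => _ [n _ <-]; apply: digit_series_le.
Qed.

Lemma digit_lim_bounds d (x : R) k : digit_series d @ \oo --> x ->
  (prefix_nat d k)%:R / b%:R ^+ k <= x <= (prefix_nat d k).+1%:R / b%:R ^+ k.
Proof.
move=> dx; have cv : cvgn (digit_series d) by apply: is_cvg_digit_series.
have <- : limn (digit_series d) = x by apply: cvg_lim.
rewrite -digit_seriesE nondecreasing_cvgn_le //=; last exact: nondecreasing_digit_series.
by apply: limr_le => //; apply: nearW => n; apply: digit_series_le.
Qed.

End DigitPrefixes.

(** * Diameters and Hausdorff measures *)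

Section HausdorffGeneral.
Variable R : realType.
Implicit Types (A : set R) (s : R).

Lemma diam_ge0 A : (0 <= diam A)%E.
Proof. by apply: ereal_sup_ubound; left. Qed.

Lemma le_diam A x y : A x -> A y -> (`|x - y|%:E <= diam A)%E.
Proof. by move=> Ax Ay; apply: ereal_sup_ubound; right; exists (x, y). Qed.

Lemma diam_le A (r : R) : 0 <= r -> (forall x y, A x -> A y -> `|x - y| <= r) ->
  (diam A <= r%:E)%E.
Proof.
move=> r0 Ar; apply: ge_ereal_sup => _ [->|[[x y] [Ax Ay] <-]]; first by rewrite lee_fin.
by rewrite lee_fin; apply: Ar.
Qed.

Lemma hausdorff_gauge_ge0 s A : (0 <= hausdorff_gauge s A)%E.
Proof. by rewrite /hausdorff_gauge; case: ifP => // _; apply: poweR_ge0. Qed.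

Lemma hausdorff_gauge0 s : hausdorff_gauge s (set0 : set R) = 0%E.
Proof. by rewrite /hausdorff_gauge asboolT. Qed.

Lemma hausdorff_premeasure_ge0 s delta A : (0 <= hausdorff_premeasure s delta A)%E.
Proof.
apply: le_ereal_inf_tmp => _ [U _ <-]; apply: nneseries_ge0 => n _ _.
exact: hausdorff_gauge_ge0.
Qed.

(** Covering by [n + 1] intervals of length [1 / (n + 1)] gives the sum [1 / (n + 1)]. This makes
    the dimension of [K] finite. *)
Lemma hausdorff_measure2_eq0 A : A `<=` `[0, 1] -> hausdorff_measure 2 A = 0%E.
Proof.
move=> A01; apply/eqP; rewrite eq_le; apply/andP; split; last first.
  apply: le_trans (hausdorff_premeasure_ge0 2 1 A) _.
  by apply: ereal_sup_ubound; exists 1 => //=.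
apply: ge_ereal_sup => _ [delta /= delta0 <-].
suff H (n : nat) : delta^-1 <= n.+1%:R ->
    (hausdorff_premeasure 2 delta A <= (n.+1%:R^-1)%:E)%E.
  apply/lee_addgt0Pr => e e0; rewrite add0e.
  pose n := Num.truncn (Num.max delta^-1 e^-1).
  have := truncnS_gt (Num.max delta^-1 e^-1); rewrite -/n gt_max => /andP[n1 n2].
  apply: le_trans (H n (ltW n1)) _; rewrite lee_fin invf_ple ?posrE //.
  exact: ltW.
move=> nd; set m : R := n.+1%:R; have m0 : 0 < m by rewrite ltr0n.
pose U i : set R := if (i < n.+1)%N then `[i%:R / m, i.+1%:R / m]%classic else set0.
have dU i : (diam (U i) <= m^-1%:E)%E.
  apply: diam_le => [|x y]; first by rewrite invr_ge0 ltW.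
  rewrite /U; case: ifP => // _; rewrite /= !in_itv /= => /andP[x1 x2] /andP[y1 y2].
  rewrite ler_norml; move: x2 y2; rewrite -natr1 mulrDl mul1r.
  move: x1 y1; move: (i%:R / m) (m^-1) => p q x1 y1 x2 y2.
  by apply/andP; split; lra.
have gU i : (hausdorff_gauge 2 (U i) <= ((i < n.+1)%N%:R * m^-1 ^+ 2)%:E)%E.
  have [il|il] := ltnP i n.+1; last first.
    rewrite /U ltnNge il /= hausdorff_gauge0 mul0r //.
  rewrite mul1r /hausdorff_gauge; case: ifP => _.
    by rewrite lee_fin exprn_ge0 // invr_ge0 ltW.
  move: (dU i) (diam_ge0 (U i)); case: (diam (U i)) => [r| |] //; rewrite !lee_fin => r1 r0.
  by rewrite powR_mulrn // lerXn2r ?nnegrE // invr_ge0 ltW.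
apply: le_trans (_ : \sum_(0 <= i <oo) hausdorff_gauge 2 (U i) <= _)%E.
  apply: ereal_inf_lbound; exists U => //; split; last first.
    by move=> i; apply: le_trans (dU i) _; rewrite lee_fin invf_ple ?posrE.
  move=> x /A01; rewrite /= in_itv /= => /andP[x0 x1].
  have xm0 : 0 <= x * m by rewrite mulr_ge0 // ltW.
  have /andP[t1 t2] := truncn_itv xm0.
  (* At [x = 1] the integer part is [n + 1], one past the last interval. *)
  have [E|lt] := eqVneq x 1.
    exists n => //; rewrite /U ltnSn /= in_itv /= E -/m divff ?gt_eqF // lexx andbT.
    by rewrite ler_pdivrMr // mul1r ler_nat.
  exists (Num.truncn (x * m)) => //; rewrite /U ifT.
    by rewrite /= in_itv /= ler_pdivrMr // t1 ler_pdivlMr // ltW.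
  rewrite truncn_lt_nat // -/m gtr_pMl // lt_neqAle lt //.
apply: lime_le; first by apply: is_cvg_nneseries => i _ _; apply: hausdorff_gauge_ge0.
apply: nearW => N.
apply: le_trans (lee_sum _ (fun i _ => gU i)) _.
rewrite sumEFin lee_fin -mulr_suml -natr_sum.
apply: le_trans (_ : n.+1%:R * m^-1 ^+ 2 <= _); last first.
  by rewrite -/m expr2 mulrA divff ?gt_eqF // mul1r.
apply: ler_wpM2r; first by rewrite exprn_ge0 // invr_ge0 ltW.
rewrite ler_nat -big_mkcond /= sum1_count /index_iota subn0.
rewrite -size_filter.
rewrite -[leqRHS](size_iota 0 n.+1); apply: uniq_leq_size; first by rewrite filter_uniq ?iota_uniq.
by move=> i; rewrite mem_filter !mem_iota => /andP[].
Qed.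

End HausdorffGeneral.

(** * Relabelling of base [b - 1] digits in base [b] *)

Section DigitRelabelling.
Variables (R : realType) (b : nat) (d0 : 'I_b).
Hypothesis b3 : (3 <= b)%N.
Local Notation c := b.-1.
Implicit Types y : R.

Let c0 : (0 < c)%N. Proof. by lia. Qed.
Let cR : 0 < c%:R :> R. Proof. by rewrite ltr0n. Qed.

Definition cfloor y n : nat := Num.truncn (c%:R ^+ n * y).

Lemma cfloor_itv y n : 0 <= y ->
  (cfloor y n)%:R / c%:R ^+ n <= y < (cfloor y n).+1%:R / c%:R ^+ n.
Proof.
move=> y0; have cn : 0 < c%:R ^+ n :> R by apply: exprn_gt0.
have /truncn_itv/andP[h1 h2] : 0 <= c%:R ^+ n * y by rewrite mulr_ge0 // ltW.
by rewrite ler_pdivrMr // ltr_pdivlMr // mulrC h1.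
Qed.

Lemma cfloor_rem y n : 0 <= y -> (cfloor y n.+1 - c * cfloor y n < c)%N /\
  (c * cfloor y n <= cfloor y n.+1)%N.
Proof.
move=> y0; have p k : 0 <= c%:R ^+ k * y by rewrite mulr_ge0 // exprn_ge0 // ltW.
have /andP[h1 h2] := truncn_itv (p n).
have le : (c * cfloor y n <= cfloor y n.+1)%N.
  by rewrite /cfloor truncn_ge_nat // natrM exprS -mulrA ler_pM2l.
have lt : (cfloor y n.+1 < c * (cfloor y n).+1)%N.
  by rewrite /cfloor truncn_lt_nat // natrM exprS -mulrA ltr_pM2l.
by split=> //; rewrite ltn_subLR // -mulnSr.
Qed.

(** The minimum makes [cdigit_lt] hold for every real [y], so that an ordinal can be formed; for
    [y >= 0] it leaves the difference unchanged. *)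
Definition cdigit y n : nat := minn (cfloor y n.+1 - c * cfloor y n) c.-1.

Lemma cdigit_lt y n : (cdigit y n < c)%N.
Proof. by rewrite /cdigit; lia. Qed.

Lemma cfloorS y n : 0 <= y -> cfloor y n.+1 = (c * cfloor y n + cdigit y n)%N.
Proof. by move=> y0; have [h1 h2] := cfloor_rem n y0; rewrite /cdigit; lia. Qed.

Lemma cfloor0 y : 0 <= y < 1 -> cfloor y 0 = 0%N.
Proof.
case/andP=> y0 y1; rewrite /cfloor expr0 mul1r; apply: truncn_def.
by rewrite y0.
Qed.

(** [lift d0] is the increasing map from the [b - 1] digits onto those other than [d0]. *)
Definition redigit y n : 'I_b := lift d0 (Ordinal (cdigit_lt y n)).

Lemma redigit_in y n : redigit y n \in [set~ d0]%SET.
Proof. by rewrite !inE eq_sym neq_lift. Qed.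

Lemma redigitE y n : redigit y n = ((d0 <= cdigit y n) + cdigit y n)%N :> nat.
Proof. by []. Qed.

Section Compare.
Variables (y y' : R).
Hypotheses (y01 : 0 <= y < 1) (y'01 : 0 <= y' < 1).
Let p := prefix_nat (redigit y).
Let p' := prefix_nat (redigit y').

(** Relabelling is increasing and never brings digits closer, and [b > c]. Hence prefixes in base
    [b] are ordered like those in base [c] and at least as far apart. The induction needs the order
    and the distances together. *)
Lemma prefix_compare n :
  ((p n < p' n)%N -> (cfloor y n < cfloor y' n)%N) /\
  ((p' n < p n)%N -> (cfloor y' n < cfloor y n)%N) /\
  ((p n <= p' n)%N -> (cfloor y' n + p n <= p' n + cfloor y n)%N) /\
  ((p' n <= p n)%N -> (cfloor y n + p' n <= p n + cfloor y' n)%N).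
Proof.
have [y0 _] := andP y01; have [y'0 _] := andP y'01.
elim: n => [|n]; first by rewrite /p /p' /= !cfloor0.
rewrite !cfloorS // /p /p' [prefix_nat _ n.+1]/= [prefix_nat (redigit y') n.+1]/=.
have := redigitE y n; have := redigitE y' n.
have := ltn_ord (redigit y n); have := ltn_ord (redigit y' n).
have := cdigit_lt y n; have := cdigit_lt y' n.
move: (redigit y n : nat) (redigit y' n : nat) => e e'.
move: (cdigit y n) (cdigit y' n) => r r'.
move: (prefix_nat (redigit y) n) (prefix_nat (redigit y') n) => P P'.
move: (cfloor y n) (cfloor y' n) => F F'.
move=> r'c rc e'b eb e'E eE [A [B [C D]]]; rewrite /bump -eE -e'E.
have bE : b = c.+1 by lia.
have mono (x1 x2 : nat) : (x1 < x2)%N -> (c * x1 + c <= c * x2)%N.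
  by move=> lt; rewrite -mulnSr leq_mul2l lt orbT.
have monob (x1 x2 : nat) : (x1 < x2)%N -> (b * x1 + b <= b * x2)%N.
  by move=> lt; rewrite -mulnSr leq_mul2l lt orbT.
have bM (x : nat) : (b * x = c * x + x)%N by rewrite {1}bE mulSn addnC.
have key (Q Q' G G' : nat) : (G' + Q <= Q' + G)%N ->
   (c * G' + c * Q <= c * Q' + c * G)%N.
  by move=> h; rewrite -!mulnDr leq_mul2l h orbT.
have [PP|PP|PP] := ltngtP P P'.
- have := A PP; have := C (ltnW PP) => h1 h2.
  have := mono _ _ h2; have := key P P' F F' h1; have := monob _ _ PP.
  rewrite !bM; lia.
- have := B PP; have := D (ltnW PP) => h1 h2.
  have := mono _ _ h2; have := key P' P F' F h1; have := monob _ _ PP.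
  rewrite !bM; lia.
- have FF : F = F'.
    have := C; have := D; rewrite PP leqnn => /(_ isT) h1 /(_ isT) h2; lia.
  rewrite PP FF; lia.
Qed.

End Compare.

(** A section of the relabelling map from [K] to the unit interval: for [0 <= y < 1], the base
    [b - 1] digits of [y] are relabelled and read in base [b]. *)
Definition reindex_point y : R := limn (digit_series R (redigit y)).

Let b0 : (0 < b)%N. Proof. by lia. Qed.

Lemma reindex_point_cvg y : digit_series R (redigit y) @ \oo --> reindex_point y.
Proof. exact: (is_cvg_digit_series (R := R) b0). Qed.

Lemma reindex_point_in y : missing_digit_set R [set~ d0]%SET (reindex_point y).
Proof.
have cv := @reindex_point_cvg y; split.
  by have := digit_lim_bounds b0 0 cv; rewrite /= expr0 !divr1.
by exists (redigit y) => // n; apply: redigit_in.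
Qed.

(** Points closer than [b ^ -m] have [P' <= P + 1] for their prefixes in base [b]. By
    [prefix_compare] the same holds in base [c], where a prefix fixes [y] up to [c ^ -m]. *)
Lemma close_points_lt y y' m : 0 <= y < 1 -> 0 <= y' < 1 ->
  `|reindex_point y - reindex_point y'| < b%:R^-1 ^+ m ->
  y' - y <= 2 * c%:R^-1 ^+ m.
Proof.
move=> y01 y'01 h; have [y0 _] := andP y01; have [y'0 _] := andP y'01.
have := digit_lim_bounds b0 m (@reindex_point_cvg y).
have := digit_lim_bounds b0 m (@reindex_point_cvg y').
have [A [B [C D]]] := prefix_compare y01 y'01 m.
have /andP[f1 f2] := cfloor_itv m y0; have /andP[f3 f4] := cfloor_itv m y'0.
move: A B C D f1 f2 f3 f4.
set P := prefix_nat _ _; set P' := prefix_nat _ _; set F := cfloor y m; set F' := cfloor y' m.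
move=> A B C D f1 f2 f3 f4 /andP[q1 q2] /andP[q3 q4].
have bm : 0 < b%:R ^+ m :> R by rewrite exprn_gt0 // ltr0n.
have cm : 0 < c%:R ^+ m :> R by rewrite exprn_gt0.
suff FF : (F' <= F.+1)%N.
  apply: le_trans (_ : F.+2%:R / c%:R ^+ m - F%:R / c%:R ^+ m <= _).
    apply: lerB => //; apply: le_trans (ltW f4) _.
    by rewrite ler_pM2r ?invr_gt0 // ler_nat.
  by rewrite -mulrBl exprVn -[F.+2]addn2 natrD addrAC subrr add0r.
have [lt|PP] := ltnP P' P; first exact: leqW (ltnW (B lt)).
have P1 : (P' <= P.+1)%N.
  rewrite -ltnS -(ltr_nat R).
  move: q1 q4; rewrite ler_pdivrMr // ler_pdivlMr // => q1 q4.
  have : (reindex_point y' - reindex_point y) * b%:R ^+ m < 1.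
    rewrite -(ltr_pM2r bm) exprVn mulVf ?gt_eqF // in h; apply: le_lt_trans h.
    by apply: ler_wpM2r; [exact: ltW|rewrite distrC ler_norm].
  rewrite mulrBl -[P.+2]addn1 natrD; lra.
by rewrite -(leq_add2r P); apply: leq_trans (C PP) _; rewrite addSnnS addnC leq_add2l.
Qed.

Lemma close_points y y' m : 0 <= y < 1 -> 0 <= y' < 1 ->
  `|reindex_point y - reindex_point y'| < b%:R^-1 ^+ m ->
  `|y - y'| <= 2 * c%:R^-1 ^+ m.
Proof.
move=> y01 y'01 h; rewrite ler_norml lerNl opprB (close_points_lt y01 y'01 h).
by rewrite (close_points_lt y'01 y01) // distrC.
Qed.

Definition kappa0 : R := ln c%:R / ln b%:R.

Let bR1 : 1 < b%:R :> R. Proof. by rewrite ltr1n; lia. Qed.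
Let cR1 : 1 < c%:R :> R. Proof. by rewrite ltr1n; lia. Qed.

Lemma kappa0_gt0 : 0 < kappa0.
Proof. by rewrite divr_gt0 // ln_gt0. Qed.

Lemma powR_kappa0 : b%:R `^ kappa0 = c%:R.
Proof.
rewrite /powR gt_eqF ?(lt_trans ltr01) // /kappa0 divfK ?gt_eqF ?ln_gt0 //.
by rewrite lnK // posrE.
Qed.

(** For [m] with [b ^ -(m + 1) <= h < b ^ -m], [close_points] bounds the left side by [2 c ^ -m],
    and [c ^ -(m + 1)] is the [kappa0]-th power of [b ^ -(m + 1)]. No such [m] exists when [h >= 1]
    or [h = 0]. *)
Lemma reindex_hoelder y y' : 0 <= y < 1 -> 0 <= y' < 1 ->
  `|y - y'| <= 2 * c%:R * `|reindex_point y - reindex_point y'| `^ kappa0.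
Proof.
move=> y01 y'01; set h := `|_ - reindex_point _|.
have h0 : 0 <= h by apply: normr_ge0.
have [h1|h1] := leP 1 h.
  have : 1 <= h `^ kappa0.
    have <- : 1 `^ kappa0 = 1 by rewrite powR1.
    by apply: ge0_ler_powR; rewrite ?nnegrE ?ler01 // ltW // kappa0_gt0.
  move=> hk; apply: le_trans (_ : 1 <= _).
    by rewrite ler_norml; move: y01 y'01 => /andP[? ?] /andP[? ?]; apply/andP; split; lra.
  have : 1 <= c%:R * h `^ kappa0 by rewrite mulr_ege1 // ltW.
  lra.
have bV : 0 < b%:R^-1 :> R by rewrite invr_gt0 (lt_trans ltr01).
have [hp|hz] := ltP 0 h; last first.
  have {hz}hE : h = 0 by apply/eqP; rewrite eq_le hz h0.
  have all_m m : `|y - y'| <= 2 * c%:R^-1 ^+ m.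
    apply: close_points => //; by rewrite -/h hE exprn_gt0.
  suff -> : `|y - y'| = 0 by rewrite mulr_ge0 ?powR_ge0 // mulr_ge0 // ltW.
  apply/eqP; rewrite eq_le normr_ge0 andbT leNgt; apply/negP => pos.
  pose m := Num.truncn (2 / `|y - y'|).
  have := truncnS_gt (2 / `|y - y'|); rewrite -/m ltr_pdivrMr // => lt.
  have := all_m m.+1; rewrite exprVn ler_pdivlMr ?exprn_gt0 // => le.
  have : m.+1%:R <= c%:R ^+ m.+1 :> R.
    by rewrite -natrX ler_nat ltnW // ltn_expl //; lia.
  by rewrite -(ler_pM2l pos); lra.
have exn : exists n, b%:R^-1 ^+ n.+1 <= h.
  pose m := Num.truncn h^-1; exists m.
  have := truncnS_gt h^-1; rewrite -/m => lt.
  have bp : 0 < b%:R ^+ m.+1 :> R by rewrite exprn_gt0 // (lt_trans ltr01).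
  rewrite exprVn invf_ple ?posrE //.
  by apply: le_trans (ltW lt) _; rewrite -natrX ler_nat ltnW // ltn_expl //; lia.
case: (ex_minnP exn) => m mh mmin.
have hm : h < b%:R^-1 ^+ m.
  case: m mh mmin => [|m] _ mmin; first by rewrite expr0.
  by rewrite ltNge; apply/negP => /mmin; rewrite ltnn.
apply: le_trans (close_points y01 y'01 hm) _.
rewrite -mulrA ler_pM2l // -ler_pdivrMl // -exprS.
have -> : c%:R^-1 ^+ m.+1 = (b%:R^-1 ^+ m.+1) `^ kappa0 :> R.
  have bi : 0 <= b%:R^-1 :> R by rewrite invr_ge0.
  have ci : b%:R^-1 `^ kappa0 = c%:R^-1 :> R.
    by rewrite -powR_inv1 // -powRrM mulN1r powRN powR_kappa0.
  rewrite -ci; elim: m.+1 => [|n IH]; first by rewrite !expr0 powR1.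
  by rewrite !exprS powRM ?exprn_ge0 // IH.
apply: ge0_ler_powR; rewrite ?nnegrE ?exprn_ge0 ?invr_ge0 //.
by rewrite ltW // kappa0_gt0.
Qed.

End DigitRelabelling.

(** * Lower bound for the Hausdorff dimension *)

Section Dimension.
Variables (R : realType) (b : nat) (d0 : 'I_b).
Hypothesis b3 : (3 <= b)%N.
Let K := missing_digit_set R [set~ d0]%SET.
Local Notation kappa := (kappa0 R b).
Let x (y : R) := reindex_point d0 b3 y.
Let c := b.-1%:R : R.

(** A cover of [K] pulls back along [x] to a cover of the half-open unit interval, by sets which
    [reindex_hoelder] places in intervals of length [4 c] times the gauge of [U i]. Subadditivity of
    Lebesgue measure concludes. *)
Lemma cover_sum_ge (s : R) (U : nat -> set R) : 0 <= s <= kappa ->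
  K `<=` \bigcup_i U i -> (forall i, (diam (U i) <= 1)%E) ->
  ((4 * c)^-1%:E <= \sum_(0 <= i <oo) hausdorff_gauge s (U i))%E.
Proof.
move=> /andP[s0 sk] KU dU.
have c0 : 0 < c by rewrite ltr0n; lia.
pose V i := [set y : R | 0 <= y < 1 /\ U i (x y)].
pose y_ i := get (V i).
pose rad i := 2 * c * fine (hausdorff_gauge s (U i)).
(* Measurability of the pullback [V i] is not at hand, so it is enclosed in an interval around one
   of its points, or in the empty set when it is empty. *)
pose I i : set R := if pselect (V i !=set0) then `[y_ i - rad i, y_ i + rad i]%classic else set0.
have diamE i : exists2 r, diam (U i) = r%:E & 0 <= r <= 1.
  move: (dU i) (diam_ge0 (U i)); case: (diam (U i)) => [r| |] //.
  by rewrite !lee_fin => r1 r0; exists r => //; rewrite r0.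
have gfin i : hausdorff_gauge s (U i) \is a fin_num.
  by rewrite /hausdorff_gauge; case: ifP => // _; have [r -> _] := diamE i.
have g0 i : 0 <= fine (hausdorff_gauge s (U i)).
  by rewrite fine_ge0 // hausdorff_gauge_ge0.
have rad0 i : 0 <= rad i by rewrite mulr_ge0 // mulr_ge0 // ltW.
have VI i : V i `<=` I i.
  move=> y Vy; rewrite /I; case: pselect => [ne|]; last by case; exists y.
  have [y01 Uy] := Vy; have [z01 Uz] : V i (y_ i) by apply: getPex.
  have [r rE /andP[r0 r1]] := diamE i.
  have xr : `|x y - x (y_ i)| <= r.
    by have := le_diam Uy Uz; rewrite rE lee_fin.
  have : `|y - y_ i| <= rad i.
    apply: le_trans (reindex_hoelder d0 b3 y01 z01) _; rewrite /rad ler_pM2l ?mulr_gt0 //.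
    rewrite /hausdorff_gauge ifF; last by apply/asboolPn => E; rewrite E in Uy.
    rewrite rE /=; apply: le_trans (_ : r `^ kappa <= _).
      apply: ge0_ler_powR; rewrite ?nnegrE //.
      exact: le_trans sk.
    (* As [r <= 1], lowering the exponent from [kappa] to [s] raises the power. *)
    have [->|rne] := eqVneq r 0.
      by rewrite powR0 ?powR_ge0 // gt_eqF // kappa0_gt0.
    by apply: ger_powR => //; rewrite lt_neqAle eq_sym rne r0.
  by rewrite ler_distl /= in_itv /=.
have mI i : measurable (I i).
  by rewrite /I; case: pselect => ?; [exact: measurable_itv|exact: measurable0].
have muI i : (lebesgue_measure (I i) <= (4 * c)%:E * hausdorff_gauge s (U i))%E.
  rewrite -[X in (_ * X)%E]fineK // -EFinM.
  rewrite /I; case: pselect => ?; last by rewrite measure0 lee_fin mulr_ge0 // mulr_ge0 // ltW.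
  rewrite lebesgue_measure_itv /=; case: ifP => _; last by rewrite lee_fin mulr_ge0 // mulr_ge0 // ltW.
  by rewrite lee_fin /rad; lra.
have cov : `[0, 1[%classic `<=` \bigcup_i I i.
  move=> y; rewrite /= in_itv /= => y01.
  have [i _ Ui] := KU _ (reindex_point_in d0 b3 y).
  by exists i => //; apply: VI.
have mu01 : lebesgue_measure (`[0, 1[%classic : set R) = 1%E.
  by rewrite lebesgue_measure_itv /= lte01 oppr0 adde0.
have le1 : (1 <= \sum_(0 <= i <oo) lebesgue_measure (I i))%E.
  rewrite -mu01; apply: measure_sigma_subadditive => //.
have {le1} : (1 <= (4 * c)%:E * \sum_(0 <= i <oo) hausdorff_gauge s (U i))%E.
  apply: le_trans le1 _; rewrite -nneseriesZl; last by move=> i _; apply: hausdorff_gauge_ge0.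
  by apply: lee_nneseries => // i _; apply: measure_ge0.
have c4 : 0 < 4 * c by rewrite mulr_gt0.
by rewrite -lee_pdivrMl // mule1.
Qed.

Lemma hausdorff_dim_missing_ge : (kappa%:E <= hausdorff_dim K)%E.
Proof.
apply: le_ereal_inf_tmp => _ [s [s0 Hs] <-]; rewrite lee_fin leNgt; apply/negP => sk.
have c0 : 0 < c by rewrite ltr0n; lia.
have : ((4 * c)^-1%:E <= hausdorff_measure s K)%E.
  apply: le_trans (_ : hausdorff_premeasure s 1 K <= _)%E; last first.
    by apply: ereal_sup_ubound; exists 1 => //=.
  apply: le_ereal_inf_tmp => _ [U [KU dU] <-].
  by apply: cover_sum_ge => //; rewrite s0 ltW.
by rewrite Hs lee_fin leNgt invr_gt0 mulr_gt0.
Qed.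

(** The bound by 2 excludes the value [+oo], which [fine] would send to 0. *)
Lemma missing_dim_ge : kappa <= fine (hausdorff_dim K).
Proof.
have ge := hausdorff_dim_missing_ge.
have le : (hausdorff_dim K <= 2%:E)%E.
  apply: ereal_inf_lbound; exists 2 => //; split=> //.
  by apply: hausdorff_measure2_eq0 => z [z01 _]; rewrite /= in_itv.
by move: ge le; case: (hausdorff_dim K) => [r| |] //=; rewrite lee_fin.
Qed.

End Dimension.

(** * Recursive programs *)

Section RecursivePrograms.
Implicit Types (v : seq nat) (f g h : recfun).

Lemma rec_eval_comp1 f g v x y : rec_eval g v x -> rec_eval f [:: x] y ->
  rec_eval (RComp f [:: g]) v y.
Proof. by move=> gx fy; apply: EvalComp fy; do 2?constructor. Qed.

Lemma rec_eval_comp2 f g h v x y z : rec_eval g v x -> rec_eval h v y ->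
  rec_eval f [:: x; y] z -> rec_eval (RComp f [:: g; h]) v z.
Proof. by move=> gx hy fz; apply: EvalComp fz; do 3?constructor. Qed.

Definition radd := RPrec (RProj 0) (RComp RSucc [:: RProj 1]).
Definition rmul := RPrec RZero (RComp radd [:: RProj 1; RProj 2]).
Definition rpred := RPrec RZero (RProj 0).
(** Recursion is on the first argument, so the first argument is subtracted from the second. *)
Definition rsub := RPrec (RProj 0) (RComp rpred [:: RProj 1]).
Fixpoint rconst n := if n is n'.+1 then RComp RSucc [:: rconst n'] else RZero.

Lemma rec_eval_succ x v : rec_eval RSucc (x :: v) x.+1.
Proof. exact: (EvalSucc (x :: v)). Qed.

Lemma rec_eval_add n x : rec_eval radd [:: n; x] (n + x)%N.
Proof.
elim: n => [|n IH]; first by apply: EvalPrec0; apply: (EvalProj 0 [:: x]).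
apply: EvalPrecS IH _; apply: rec_eval_comp1; first exact: (EvalProj 1).
exact: rec_eval_succ.
Qed.

Lemma rec_eval_mul n x : rec_eval rmul [:: n; x] (n * x)%N.
Proof.
elim: n => [|n IH]; first by apply: EvalPrec0; constructor.
apply: EvalPrecS IH _; rewrite mulSn addnC.
apply: rec_eval_comp2; [exact: (EvalProj 1)|exact: (EvalProj 2)|].
exact: rec_eval_add.
Qed.

Lemma rec_eval_pred n : rec_eval rpred [:: n] n.-1.
Proof.
elim: n => [|n IH]; first by apply: EvalPrec0; constructor.
apply: EvalPrecS IH _; exact: (EvalProj 0).
Qed.

Lemma rec_eval_sub n x : rec_eval rsub [:: n; x] (x - n)%N.
Proof.
elim: n => [|n IH]; first by rewrite subn0; apply: EvalPrec0; apply: (EvalProj 0 [:: x]).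
apply: EvalPrecS IH _; rewrite subnS.
apply: rec_eval_comp1; first exact: (EvalProj 1).
exact: rec_eval_pred.
Qed.

Lemma rec_eval_const n v : rec_eval (rconst n) v n.
Proof.
elim: n => [|n IH] /=; first by constructor.
by apply: rec_eval_comp1 IH _; apply: rec_eval_succ.
Qed.

(* On input (n, b) this searches for the least m with n + 1 <= c b ^ 3 (m + 1),
   which is the integer part of n / (c b ^ 3). *)
Definition inv_cube_program (c : nat) : recfun :=
  RMu (RComp rsub
    [:: RComp rmul [:: rconst c;
          RComp rmul [:: RComp RSucc [:: RProj 0];
            RComp rmul [:: RProj 2; RComp rmul [:: RProj 2; RProj 2]]]];
        RComp RSucc [:: RProj 1]]).

(** With [Q = c b ^ 3] and [m = n %/ Q], the error is [(n + 1 - m Q) / (Q (n + 1))], where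
    [0 <= n + 1 - m Q <= Q]. *)
Lemma inv_cube_programP (R : realType) (c b : nat) (w : seq nat) :
  (0 < c)%N -> (0 < b)%N ->
  computes_real (inv_cube_program c) (b :: w) ((c%:R * b%:R ^+ 3)^-1 : R).
Proof.
move=> c0 b0 n; pose Q := (c * (b * (b * b)))%N.
have Q0 : (0 < Q)%N by rewrite !muln_gt0 c0 b0.
have -> : c%:R * b%:R ^+ 3 = Q%:R :> R by rewrite /Q !natrM; ring.
(* The minimised function is a truncated subtraction, which vanishes exactly when
   [n + 1 <= Q (m + 1)]. *)
have ev m : rec_eval (RComp rsub
    [:: RComp rmul [:: rconst c;
          RComp rmul [:: RComp RSucc [:: RProj 0];
            RComp rmul [:: RProj 2; RComp rmul [:: RProj 2; RProj 2]]]];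
        RComp RSucc [:: RProj 1]]) [:: m, n, b & w] (n.+1 - Q * m.+1)%N.
  apply: rec_eval_comp2 (rec_eval_sub _ _); last first.
    apply: rec_eval_comp1; [exact: (EvalProj 1)|exact: rec_eval_succ].
  have -> : (Q * m.+1 = c * (m.+1 * (b * (b * b))))%N by rewrite /Q; ring.
  apply: rec_eval_comp2 (rec_eval_mul _ _); first exact: rec_eval_const.
  apply: rec_eval_comp2 (rec_eval_mul _ _).
    apply: rec_eval_comp1; [exact: (EvalProj 0)|exact: rec_eval_succ].
  apply: rec_eval_comp2 (rec_eval_mul _ _); first exact: (EvalProj 2).
  by apply: rec_eval_comp2 (rec_eval_mul _ _); exact: (EvalProj 2).
exists (n %/ Q)%N.
  apply: (EvalMu (h := fun k => (n.+1 - Q * k.+1).-1)) => [k kn|].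
    have : (Q * k.+1 <= n)%N.
      by rewrite mulnC; apply: leq_trans (leq_trunc_div n Q); rewrite leq_mul2r kn orbT.
    move=> le; have := ev k.
    by rewrite -[X in rec_eval _ _ X -> _]prednK // subn_gt0 ltnS.
  have := ev (n %/ Q)%N; rewrite (_ : n.+1 - _ = 0)%N //; apply/eqP.
  by rewrite subn_eq0 mulnC; apply: ltn_ceil.
have QR : 0 < Q%:R :> R by rewrite ltr0n.
have nR : 0 < n.+1%:R :> R by rewrite ltr0n.
have l1 : (n %/ Q)%:R * Q%:R <= n.+1%:R :> R.
  by rewrite -natrM ler_nat (leq_trans (leq_trunc_div _ _)).
have l2 : n.+1%:R <= ((n %/ Q)%:R + 1) * Q%:R :> R.
  by rewrite natr1 -natrM ler_nat; apply: ltn_ceil.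
move: l1 l2; set m : R := (n %/ Q)%:R => l1 l2.
have -> : Q%:R^-1 - m / n.+1%:R = (n.+1%:R - m * Q%:R) / Q%:R * n.+1%:R^-1 :> R.
  by field; rewrite !gt_eqF.
have i0 : 0 <= n.+1%:R^-1 :> R by rewrite invr_ge0 ltW.
rewrite normrM (ger0_norm i0) ler_piMl // ger0_norm.
  by rewrite ler_pdivrMr // mul1r; lra.
by rewrite divr_ge0 ?(ltW QR) // subr_ge0.
Qed.

End RecursivePrograms.

(** * Counting rationals *)

Section RationalsInCylinders.
Variables (R : realType) (b : nat) (D : {set 'I_b}) (k T : nat).
Hypotheses (b0 : (0 < b)%N) (TN : (T ^ 2 < b ^ k)%N).
Let N := (b ^ k)%N.
Let X := [set x : R | missing_digit_set R D x /\
    exists2 q : nat, (1 <= q <= T)%N & q%:R * x \is a Num.int].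
Let cyl (a : nat) := [set x : R | X x /\ exists2 d : nat -> 'I_b,
  (forall n, d n \in D) & digit_series R d @ \oo --> x /\ prefix_nat d k = a].

Let NR : 0 < N%:R :> R. Proof. by rewrite ltr0n expn_gt0 b0. Qed.

Let cyl_bounds a x : cyl a x -> a%:R <= x * N%:R <= a%:R + 1.
Proof.
move=> [_ [d _ [dx <-]]].
by have := digit_lim_bounds b0 k dx; rewrite -natrX ler_pdivrMr // ler_pdivlMr // natr1.
Qed.

(* Two distinct fractions of denominators at most T are at least T ^ -2 apart. *)
Let cyl_inj a x y : cyl a x -> cyl a y -> x = y.
Proof.
move=> cx cy; have /andP[x1 x2] := cyl_bounds cx; have /andP[y1 y2] := cyl_bounds cy.
case: cx cy => [[_ [q /andP[q1 qT] qx]] _] [[_ [r /andP[r1 rT] ry]] _].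
apply/eqP; rewrite -subr_eq0; apply/negP => /negP xy.
have int : q%:R * r%:R * (x - y) \is a Num.int.
  have -> : q%:R * r%:R * (x - y) = r%:R * (q%:R * x) - q%:R * (r%:R * y) by ring.
  by rewrite rpredB // rpredM // natr_int.
have ne : q%:R * r%:R * (x - y) != 0.
  by rewrite !mulf_neq0 // pnatr_eq0 -lt0n.
have := norm_intr_ge1 int ne; apply/negP; rewrite -ltNge.
rewrite -(ltr_pM2r NR) mul1r normrM ger0_norm ?mulr_ge0 // -mulrA.
have xyN : `|x - y| * N%:R <= 1.
  have -> : `|x - y| * N%:R = `|x * N%:R - y * N%:R|.
    by rewrite -mulrBl normrM (ger0_norm (ltW NR)).
  rewrite ler_norml.
  by apply/andP; split; lra.
apply: le_lt_trans (_ : q%:R * r%:R < _).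
  by rewrite ler_piMr // mulr_ge0.
rewrite -natrM ltr_nat; apply: leq_ltn_trans TN.
by rewrite expnS expn1 leq_mul.
Qed.

(** A point [x] of the cylinder of [a] has [0 <= N x - a <= 1]; if [q x = p] is an integer, then
    [t = p N - a q] lies between 0 and [q]. Points are counted by prefixes of chosen expansions,
    which determine them by [cyl_inj]. *)
Lemma rational_count_le_words : exists2 B : seq nat,
  (rational_count (missing_digit_set R D) T <= (size B)%:R%:E)%E &
  [/\ uniq B, {subset B <= digit_words D k} &
    forall a, a \in B -> exists q t p,
      [/\ (q < T)%N, (t <= T)%N & (a * q.+1 + t = p * b ^ k)%N]].
Proof.
pose B := [seq a <- undup (digit_words D k) | `[< cyl a !=set0 >]].
exists B; last first.
  split; first by rewrite filter_uniq ?undup_uniq.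
    by move=> a; rewrite mem_filter mem_undup => /andP[].
  move=> a; rewrite mem_filter => /andP[/asboolP[x cx] _].
  have /andP[x1 x2] := cyl_bounds cx.
  case: cx => [[[/andP[x0 _] _] [q /andP[q1 qT] qx]] _].
  have /natrP[p pE] : q%:R * x \is a Num.nat by rewrite natrEint qx mulr_ge0.
  (* Denominators are written [q.+1] with [q < T], hence the predecessor. *)
  exists q.-1, (p * N - a * q)%N, p.
  have le1 : (a * q <= p * N)%N.
    rewrite -(ler_nat R) !natrM -pE mulrC -mulrA ler_wpM2l //.
  have le2 : (p * N <= a * q + q)%N.
    rewrite -(ler_nat R) natrD !natrM -pE -mulrA -[X in _ <= _ + X]mul1r -mulrDl mulrC.
    by rewrite ler_wpM2r.
  split; [by rewrite prednK| |rewrite prednK // subnKC //].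
  by rewrite leq_subLR (leq_trans le2) // leq_add2l.
pose f (i : nat) : R := get (cyl (nth 0%N B i)).
have XI : X `<=` f @` `I_(size B).
  move=> x Xx; have [[x01 [d dD dx]] _] := Xx.
  pose a := prefix_nat d k.
  have cx : cyl a x by split=> //; exists d.
  have aB : a \in B.
    rewrite mem_filter mem_undup prefix_nat_words // andbT.
    by apply/asboolP; exists x.
  exists (index a B); first by rewrite /= index_mem.
  have cg : cyl a (get (cyl a)) by apply: getPex; exists x.
  by rewrite /f nth_index //; apply: cyl_inj cg cx.
have cX : (X #<= `I_(size B))%card.
  by apply: card_le_trans (subset_card_le XI) (card_image_le _ _).
rewrite /rational_count /counting asboolT; last by apply/finite_set_leP; exists (size B).
by rewrite lee_fin ler_nat; apply: geq_card_fset_set.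
Qed.

End RationalsInCylinders.

(** * Choice of parameters and power saving *)

Lemma ln_natr_le (R : realType) (n : nat) : (0 < n)%N -> ln (n%:R : R) <= n%:R.
Proof.
move=> n0; have := @le_ln1Dx R (n%:R - 1); rewrite addrCA subrr addr0 => h.
have n1 : 1 <= n%:R :> R by rewrite ler1n.
by apply: le_trans (h _) _; lra.
Qed.

(** One has [ln b - ln (b - 1) = - ln (1 - 1 / b) >= 1 / b] and [ln b <= b]. A rational bound makes
    the saving easy to compute. *)
Lemma codim_ge (R : realType) (b : nat) : (2 <= b)%N ->
  (b%:R ^+ 2)^-1 <= 1 - kappa0 R b :> R.
Proof.
move=> b2; rewrite /kappa0.
have b1 : 1 < b%:R :> R by rewrite ltr1n.
have bp : 0 < b%:R :> R by apply: lt_trans b1.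
have c0 : 0 < b.-1%:R :> R by rewrite ltr0n; lia.
have lb : 0 < ln (b%:R : R) by rewrite ln_gt0.
have cE : b.-1%:R = b%:R * (1 - b%:R^-1) :> R.
  by rewrite mulrBr mulr1 divff ?gt_eqF // -subn1 natrB // ltnW.
have i1 : b%:R^-1 < 1 :> R by rewrite invf_lt1.
have lnc : ln (b.-1%:R : R) <= ln b%:R - b%:R^-1.
  rewrite cE lnM ?posrE // ?subr_gt0 // lerD2l.
  by apply: le_ln1Dx; lra.
have -> : 1 - ln b.-1%:R / ln b%:R = (ln b%:R - ln b.-1%:R) / ln b%:R :> R.
  by rewrite mulrBl divff ?gt_eqF.
rewrite ler_pdivlMr //; apply: le_trans (_ : b%:R^-1 <= _); last by lra.
rewrite expr2 invfM -mulrA; apply: ler_piMr; first by rewrite invr_ge0 ltW.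
by rewrite mulrC ler_pdivrMr // mul1r ln_natr_le // ltnW.
Qed.

(** Here [b ^ -tau = exp (- tau ln b) >= 1 - tau b = 999 / 1000]. *)
Lemma gap_ratio_powR (R : realType) (b : nat) (tau : R) : (1 <= b)%N ->
  tau * (1000 * b%:R) = 1 -> 998 / 1000 <= (b%:R `^ tau)^-1.
Proof.
move=> b1 tauE; have bp : 0 < b%:R :> R by rewrite ltr0n.
have -> : (b%:R `^ tau)^-1 = expR (- (tau * ln b%:R)).
  by rewrite /powR gt_eqF // expRN.
apply: le_trans (expR_ge1Dx _).
have l : ln (b%:R : R) <= b%:R by apply: ln_natr_le.
have P0 : 0 < 1000 * b%:R :> R by lra.
have t0 : 0 < tau by rewrite -(pmulr_lgt0 tau P0) tauE ltr01.
have := ler_wpM2l (ltW t0) l; lra.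
Qed.

Lemma powR_exprn (R : realType) (x a : R) n : 0 <= x -> (x ^+ n) `^ a = (x `^ a) ^+ n.
Proof.
move=> x0; elim: n => [|n IH]; first by rewrite !expr0 powR1.
by rewrite !exprS powRM ?exprn_ge0 // IH.
Qed.

(** [N = b ^ k] is the least power that is at least [8 T ^ (2 + tau)]. With divisor exponent
    [tau / 2], the count is at most a constant times [T ^ 2 N ^ (kap - 1) + T N ^ (kap - 1 / 2 - tau
    / 2)]. Both terms have exponent at most [2 kap - tau (1 - kap)] in [T], and
    [1 - kap >= b ^ -2]. *)
Lemma missing_count_le (R : realType) (b : nat) (d0 : 'I_b) (tau th : R) : (4 <= b)%N ->
  0 < tau -> th <= (b%:R `^ tau)^-1 ->
  (exists om lam : R, [/\ -1/2 <= om <= 1/2, 0 <= lam,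
    lam <= th * (b.-1%:R * Num.sqrt b%:R) & subsolution [set~ d0]%SET om lam]) ->
  exists2 C : R, 0 < C & forall T : nat, (1 <= T)%N ->
    (rational_count (missing_digit_set R [set~ d0]%SET) T <=
      (C * T%:R `^ (2 * kappa0 R b - tau / b%:R ^+ 2))%:E)%E.
Proof.
move=> b4 tau0 thle [om [lam [om12 lam0 lamle sub]]].
set kap := kappa0 R b.
have b0 : (0 < b)%N by lia.
have b1 : (1 < b)%N by lia.
have b3 : (3 <= b)%N by lia.
have bR : 0 < b%:R :> R by rewrite ltr0n.
have bR4 : 4 <= b%:R :> R by rewrite ler_nat.
have kap0 : 0 < kap := kappa0_gt0 R b3.
have codim := codim_ge R (ltnW b3 : (2 <= b)%N).
have kap1 : kap <= 1.
  by rewrite -subr_ge0; apply: le_trans codim; rewrite invr_ge0 exprn_ge0 // ltW.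
have eps0 : 0 < tau / 2 by rewrite divr_gt0.
have [Cd Cd0 hCd] := divisor_bound eps0.
pose W := (8 * b%:R) `^ kap : R.
have W0 : 0 <= W by apply: powR_ge0.
(* 128 comes from [8 / J <= 128 T / N], and 384 is 128 times the 3 of [expsum_l1]. *)
pose C := 128 + 384 * (Cd * W).
have CW0 : 0 <= Cd * W by rewrite mulr_ge0 // ltW.
have C0 : 0 < C by rewrite /C; lra.
exists C => // T T1.
pose t : R := T%:R.
have t1 : 1 <= t by rewrite ler1n.
have t0 : 0 < t by apply: lt_le_trans t1.
pose z := t `^ (2 + tau).
have z0 : 0 < z by apply: powR_gt0.
have zge : t ^+ 2 <= z.
  by rewrite -(powR_mulrn 2 (ltW t0)); apply: (ler_powR t1); lra.
(* The factor 8 ensures [8 T <= N], so that [J] below is positive. *)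
have exk : exists k, 8 * z <= (b ^ k)%:R.
  pose m := Num.truncn (8 * z); exists m.+1.
  apply: le_trans (ltW (truncnS_gt _)) _; rewrite -/m ler_nat ltnW //.
  exact: ltn_expl.
case: (ex_minnP exk) => k kz kmin.
set N := (b ^ k)%N in kz; pose v : R := N%:R.
have v0 : 0 < v by rewrite /v; lra.
have vle : v <= 8 * b%:R * z.
  case: k kmin @N @v {kz v0} => [|k] kmin N v.
    rewrite /v /N expn0; have : 1 <= z by apply: le_trans zge; rewrite exprn_ege1.
    by move=> z1; nra.
  have : ~~ (8 * z <= (b ^ k)%:R) by apply/negP => /kmin; rewrite ltnn.
  rewrite -ltNge => lt; rewrite /v /N expnS natrM mulrAC mulrC ler_pM2r //.
  exact: ltW.
have TN : (T ^ 2 < b ^ k)%N.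
  rewrite -(ltr_nat R) natrX -/t -/N -/v; apply: le_lt_trans zge _.
  by apply: lt_le_trans kz; lra.
have [B cntB [uB sB hB]] := rational_count_le_words R [set~ d0]%SET b0 TN.
apply: le_trans cntB _; rewrite lee_fin.
(* The longest kernel allowed by [8 T J <= N]. *)
pose J := (N %/ (8 * T))%N.
have TJ : (8 * T * J <= N)%N by rewrite mulnC; apply: leq_trunc_div.
have T8 : (0 < 8 * T)%N by rewrite muln_gt0.
have tz : 8 * t <= v.
  apply: le_trans kz; rewrite ler_pM2l //; apply: le_trans zge.
  by rewrite expr2 ler_peMl // ltW.
have J0 : (0 < J)%N.
  by rewrite divn_gt0 // -(ler_nat R) natrM.
have JR : 0 < J%:R :> R by rewrite ltr0n.
have NJ : v <= 16 * t * J%:R.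
  have lt : (N < 8 * T * J.+1)%N by rewrite mulnC; apply: ltn_ceil.
  have le : (N <= 16 * T * J)%N.
    apply: leq_trans (ltnW lt) _.
    have -> : (16 * T * J = 8 * T * (2 * J))%N by rewrite mulnACA mulnA.
    rewrite leq_mul2l; apply/orP; right.
    by rewrite mul2n -addnn -[J.+1]addn1 leq_add2l.
  by rewrite /v /t -!natrM ler_nat.
pose M := Cd * v `^ (tau / 2).
have M0 : 0 <= M by rewrite mulr_ge0 ?powR_ge0 // ltW.
have hM n : (0 < n < N)%N -> (size (divisors n))%:R <= M.
  case/andP=> n0 nN; apply: le_trans (hCd n n0) _; rewrite /M ler_pM2l //.
  apply: ge0_ler_powR; [exact: ltW|by rewrite nnegrE|by rewrite nnegrE ltW|].
  by rewrite /v ler_nat ltnW.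
have := @fejer_count R b [set~ d0]%SET k b0 T J M B J0 TJ M0 hM uB sB hB.
have l1 := expsum_l1 k b0 om12 lam0 sub.
rewrite cardC1_ord -/N.
set G := \sum_(n < N) _ => cnt.
have ckE : (b.-1 ^ k)%:R = v `^ kap.
  by rewrite /v /N !natrX (powR_exprn _ _ (ltW bR)) powR_kappa0.
(* From [th <= b ^ -tau], [b - 1 = b ^ kap] and [sqrt b = b ^ (1 / 2)]. *)
have lamk : lam ^+ k <= v `^ (kap - tau + 1 / 2).
  apply: le_trans (_ : (th * (b.-1%:R * Num.sqrt b%:R)) ^+ k <= _).
    by apply: lerXn2r => //; rewrite nnegrE //; apply: le_trans lamle.
  rewrite /v /N natrX (powR_exprn _ _ (ltW bR)); apply: lerXn2r; rewrite ?nnegrE ?powR_ge0 //.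
    exact: le_trans lamle.
  have bne (P : bool) : P ==> (b%:R != 0 :> R) by rewrite (gt_eqF bR) implybT.
  rewrite powRD // powRB //.
  rewrite powR_kappa0 // (_ : 1 / 2 = 2^-1); last by rewrite mul1r.
  rewrite (powR12_sqrt (ltW bR)).
  have -> : b.-1%:R / b%:R `^ tau * Num.sqrt b%:R =
    (b%:R `^ tau)^-1 * (b.-1%:R * Num.sqrt b%:R) by ring.
  by apply: ler_wpM2r thle; rewrite mulr_ge0 ?sqrtr_ge0.
have step1 : (size B)%:R <= 128 * t / v * (t * v `^ kap + M * (3 * v `^ (kap - tau + 1 / 2))).
  apply: le_trans cnt _; apply: ler_pM.
  - by rewrite divr_ge0.
  - apply: addr_ge0; apply: mulr_ge0 => //; apply: sumr_ge0 => i _; exact: cmod_ge0.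
  - rewrite ler_pdivrMr // mulrAC ler_pdivlMr //; nra.
  - rewrite ckE lerD2l; apply: ler_wpM2l => //; apply: le_trans l1 _.
    by rewrite ler_pM2l.
apply: le_trans step1 _.
have vne (x : R) : (x == 0) ==> (v != 0) by rewrite (gt_eqF v0) implybT.
have tne (x : R) : (x == 0) ==> (t != 0) by rewrite (gt_eqF t0) implybT.
have zge8 : z <= v by apply: le_trans kz; lra.
pose target := t `^ (2 * kap - tau / b%:R ^+ 2).
have tar0 : 0 <= target by apply: powR_ge0.
have inv_le (a : R) : 0 <= a -> (v `^ a)^-1 <= (z `^ a)^-1.
  move=> a0; rewrite lef_pV2 ?posrE ?powR_gt0 //.
  by apply: ge0_ler_powR => //; rewrite nnegrE ltW.
have zE (a : R) : z `^ a = t `^ ((2 + tau) * a) by rewrite powRrM.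
have rhoE : tau / b%:R ^+ 2 <= tau * (1 - kap) by rewrite ler_pM2l.
have rho2 : tau / b%:R ^+ 2 <= tau / 2.
  rewrite ler_pM2l // lef_pV2 ?posrE ?exprn_gt0 //; nra.
have first : t * t * (v `^ (1 - kap))^-1 <= target.
  apply: le_trans (_ : t * t * (z `^ (1 - kap))^-1 <= _).
    by rewrite ler_pM2l ?mulr_gt0 // inv_le // subr_ge0.
  rewrite zE -powRN -expr2 -(powR_mulrn 2 (ltW t0)) -powRD // /target.
  by apply: (ler_powR t1); lra.
(* The growing factor uses [v <= 8 b z], at the cost of [W], and the decaying one uses [z <= v]. *)
have second : t * (v `^ kap * (v `^ ((1 + tau) / 2))^-1) <= W * target.
  apply: le_trans (_ : t * ((W * z `^ kap) * (z `^ ((1 + tau) / 2))^-1) <= _).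
    rewrite ler_pM2l //; apply: ler_pM; rewrite ?invr_ge0 ?powR_ge0 //.
      have b80 : 0 <= 8 * b%:R :> R by lra.
      rewrite /W -(powRM _ b80 (ltW z0)); apply: ge0_ler_powR; [exact: ltW| | |exact: vle].
        by rewrite nnegrE ltW.
      by rewrite nnegrE mulr_ge0 // ltW.
    by apply: inv_le; lra.
  have -> : t * (W * z `^ kap * (z `^ ((1 + tau) / 2))^-1) =
    W * (t * z `^ kap * (z `^ ((1 + tau) / 2))^-1) by ring.
  apply: ler_wpM2l => //.
  rewrite !zE -powRN -{1}(powRr1 (ltW t0)) -!powRD // /target.
  apply: (ler_powR t1).
  have : 0 <= tau * (1 - kap) by rewrite mulr_ge0 ?subr_ge0 // ltW.
  have : 0 <= tau * tau by rewrite mulr_ge0 ?ltW.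
  by lra.
have E1 : v^-1 * v `^ kap = (v `^ (1 - kap))^-1.
  by rewrite -powRN -(powR_inv1 (ltW v0)) -powRD //; congr (_ `^ _); ring.
have E2 : v^-1 * (v `^ (tau / 2) * v `^ (kap - tau + 1 / 2)) =
    v `^ kap * (v `^ ((1 + tau) / 2))^-1.
  by rewrite -powRN -(powR_inv1 (ltW v0)) -!powRD //; congr (_ `^ _); field.
have -> : 128 * t / v * (t * v `^ kap + M * (3 * v `^ (kap - tau + 1 / 2))) =
  128 * (t * t * (v^-1 * v `^ kap)) +
  384 * Cd * (t * (v^-1 * (v `^ (tau / 2) * v `^ (kap - tau + 1 / 2)))).
  by rewrite /M; ring.
rewrite E1 E2 /C -/target.
have := ler_wpM2l (ltW Cd0) second; lra.
Qed.

Theorem theorem1p2 (R : realType) :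
  exists e : recfun,
  forall (b : nat) (D : {set 'I_b}), (2 <= b)%N ->
    ((5 <= b)%N /\ #|D| = b.-1) \/
    (b = 4%N /\
      (D = [set i : 'I_b | (i : nat) \in [:: 0; 1; 2]%N]%SET \/
       D = [set i : 'I_b | (i : nat) \in [:: 1; 2; 3]%N]%SET)) ->
  let K := missing_digit_set R D in
  let kappa := fine (hausdorff_dim K) in
  exists2 rho : R, 0 < rho /\ computes_real e [:: b; digit_code D] rho &
  exists2 C : R, 0 < C &
  forall T : nat, (1 <= T)%N ->
    (rational_count K T <= (C * T%:R `^ (2 * kappa - rho))%:E)%E.
Proof.
(* The saving is [1 / (1000 b ^ 3) = tau / b ^ 2] with [tau = 1 / (1000 b)]. *)
exists (inv_cube_program 1000) => b D b2 hD K kappa.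
have [d0 DE hd0] : exists2 d0 : 'I_b, D = [set~ d0]%SET &
    (5 <= b)%N \/ b = 4 /\ (d0 == 0 :> nat) || (d0 == 3 :> nat).
  case: hD => [[b5 cD]|[b4 hD]].
    have /cards1P[d0 d0E] : #|~: D| == 1%N.
      by rewrite cardsCs finset.setCK cD card_ord; apply/eqP; lia.
    by exists d0; [rewrite -d0E finset.setCK|left].
  subst b; case: hD => ->.
    exists ord_max; last by right.
    by apply/finset.setP => -[[|[|[|[|i]]]] hi]; rewrite !inE -val_eqE.
  exists ord0; last by right.
  by apply/finset.setP => -[[|[|[|[|i]]]] hi]; rewrite !inE -val_eqE.
have b4 : (4 <= b)%N by case: hd0 => [|[? _]]; lia.
have bR : 0 < b%:R :> R by rewrite ltr0n; lia.
have [n1000 n1000E] : exists x : R, x = 1000%:R by eexists.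
have n0 : 0 < n1000 by rewrite n1000E ltr0n.
have tauE : (n1000 * b%:R)^-1 * (1000 * b%:R) = 1 :> R.
  by rewrite -n1000E mulVf // gt_eqF // mulr_gt0.
have rhoE : (1000%:R * b%:R ^+ 3)^-1 = (n1000 * b%:R)^-1 / b%:R ^+ 2 :> R.
  by rewrite -n1000E; field; rewrite !gt_eqF.
exists (1000%:R * b%:R ^+ 3)^-1.
  split; last by apply: inv_cube_programP; lia.
  by rewrite -n1000E invr_gt0 mulr_gt0 // exprn_gt0.
have tau0 : 0 < (n1000 * b%:R)^-1 by rewrite invr_gt0 mulr_gt0.
have thle := gap_ratio_powR (ltnW b2) tauE.
have [C C0 hC] := missing_count_le b4 tau0 thle (exists_subsolution R hd0).
exists C => // T T1; rewrite /K DE; apply: le_trans (hC T T1) _.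
(* For [T >= 1] the exponent may be raised from [kappa0] to [kappa], by the lower bound for the
   dimension. *)
rewrite lee_fin ler_pM2l // rhoE; apply: ler_powR; first by rewrite ler1n.
have := missing_dim_ge R d0 (ltnW b4 : (3 <= b)%N); rewrite /kappa /K DE; lra.
Qed.
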